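(* The space $\mathcal M_{\mathcal G,\Gamma}$ of all $\Gamma$-mixing actions of $\mathcal G$ is a complete separable metric space with respect to the metric $$\mathrm m_{\mathcal G,\Gamma}(T,S)=\sum_i 2^{-i}\sup_{g\in K_i}\mathrm d(T^g,S^g)+\sup_{g\in\Gamma}\mathrm a(T^g,S^g).$$
   Context: $(X,\Sigma,\mu)$ is a separable Lebesgue space with a non-atomic probability measure $\mu$. $\mathcal A$ is the group of invertible measure-preserving transformations of $X$, two transformations being identified if they agree outside a null set. Fix a countable family $\{A_i\}_{i\in\mathbb N}\subset\Sigma$ that generates $\Sigma$ and is dense in $\Sigma$ (for every $A\in\Sigma$ and $\varepsilon>0$ there is $i$ with $\mu(A_i\triangle A)<\varepsilon$). For $T,S\in\mathcal A$ put $\mathrm d(T,S)=\sum_{i}2^{-i}\big(\mu(TA_i\triangle SA_i)+\mu(T^{-1}A_i\triangle S^{-1}A_i)\big)$ and $\mathrm a(T,S)=\sum_{i,j}2^{-(i+j)}|\mu(TA_i\cap A_j)-\mu(SA_i\cap A_j)|$. $\mathcal G$ is a Hausdorff locally compact group with a countable neighborhood base, with identity $e$. Fix an at most countable family $\{K_i\}$ of compact subsets of $\mathcal G$ with nonempty interiors whose union contains a set generating $\mathcal G$. An action of $\mathcal G$ is a family $T=\{T^g\}_{g\in\mathcal G}\subset\mathcal A$ with $T^gT^h=T^{gh}$ for all $g,h\in\mathcal G$ and such that $g\mapsto\mu(T^gA\cap B)$ is continuous on $\mathcal G$ for all $A,B\in\Sigma$. Let $\Gamma\subset\mathcal G$ be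 an unbounded subset (not contained in any compact set). An action $T$ is $\Gamma$-mixing if for all $A,B\in\Sigma$ and $\varepsilon>0$ there is a compact $C\subset\mathcal G$ with $|\mu(T^gA\cap B)-\mu(A)\mu(B)|<\varepsilon$ for all $g\in\Gamma\setminus C$. $\mathcal M_{\mathcal G,\Gamma}$ is the set of all $\Gamma$-mixing actions of $\mathcal G$. *)

(* Defs.v *)
From HB Require Import structures.
From mathcomp Require Import all_boot all_order all_algebra.
From mathcomp Require Import all_classical all_reals all_analysis.
Set Implicit Arguments. Unset Strict Implicit. Unset Printing Implicit Defensive.
Import Order.TTheory GRing.Theory Num.Theory.
Import numFieldNormedType.Exports.
Local Open Scope classical_set_scope.
Local Open Scope ring_scope.

Definition rsum {R : realType} (u : nat -> R) : R := limn (series u).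

Section Defs.
Context (R : realType) (d : measure_display) (X : measurableType d)
  (mu : probability X R).

Definition mr (A : set X) : R := fine (mu A).

Definition symdiff (A B : set X) : set X := (A `\` B) `|` (B `\` A).

Definition mnull (N : set X) : Prop := measurable N /\ mu N = 0%E.

Definition ae_equal (f g : X -> X) : Prop :=
  exists N, mnull N /\ forall x, ~ N x -> f x = g x.

(* (X, Sigma, mu) is a separable Lebesgue space with non-atomic measure:
   isomorphic mod 0 to ([0,1], Lebesgue measure). *)
Definition nonatomic_lebesgue_space : Prop :=
  exists (N : set X) (N' : set R) (phi : X -> R),
    mnull N /\ measurable N' /\ lebesgue_measure N' = 0%E /\
    measurable_fun setT phi /\
    {in ~` N &, injective phi} /\
    phi @` (~` N) = `[0, 1] `\` N' /\
    (forall B, measurable B -> B `<=` ~` N -> measurable (phi @` B)) /\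
    (forall C : set R, measurable C ->
       mu (phi @^-1` C) = lebesgue_measure (C `&` `[0, 1])).

Definition nonatomic : Prop :=
  forall A, measurable A -> (0 < mu A)%E ->
    exists B, measurable B /\ B `<=` A /\ (0 < mu B)%E /\ (mu B < mu A)%E.

(* Invertible measure-preserving transformation (a representative of an
   element of the group \mathcal A). *)
Definition inv_mpt (T : X -> X) : Prop :=
  measurable_fun setT T /\
  (exists T' : X -> X, cancel T T' /\ cancel T' T /\ measurable_fun setT T') /\
  (forall A, measurable A -> mu (T @^-1` A) = mu A).

Definition dA (A : nat -> set X) (T S : X -> X) : R :=
  rsum (fun i => (2%:R ^- i) *
     (mr (symdiff (T @` A i) (S @` A i)) +
      mr (symdiff (T @^-1` A i) (S @^-1` A i)))).

Definition aA (A : nat -> set X) (T S : X -> X) : R :=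
  rsum (fun i => rsum (fun j => (2%:R ^- (i + j)) *
     `| mr (T @` A i `&` A j) - mr (S @` A i `&` A j) |)).

End Defs.

Section Groups.
Context (G : topologicalType) (mul : G -> G -> G) (inv : G -> G) (e : G).

Definition lc_group : Prop :=
  [/\ (forall x y z, mul x (mul y z) = mul (mul x y) z),
      (forall x, mul e x = x /\ mul x e = x),
      (forall x, mul (inv x) x = e /\ mul x (inv x) = e),
      continuous (fun p : G * G => mul p.1 p.2) & continuous inv] /\
  [/\ hausdorff_space G,
      (forall x : G, exists C : set G, compact C /\ nbhs x C) &
      (forall x : G, exists U : nat -> set G,
          (forall n, nbhs x (U n)) /\
          (forall V, nbhs x V -> exists n, U n `<=` V))].

Definition subgroup (H : set G) : Prop :=
  H e /\ (forall x y, H x -> H y -> H (mul x y)) /\ (forall x, H x -> H (inv x)).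

Definition generates_group (S : set G) : Prop :=
  forall H, subgroup H -> S `<=` H -> H = setT.

Definition unbounded (Gam : set G) : Prop :=
  forall C : set G, compact C -> ~ (Gam `<=` C).
End Groups.

Section Actions.
Context (R : realType) (d : measure_display) (X : measurableType d)
  (mu : probability X R) (G : topologicalType) (mul : G -> G -> G).

(* an action of G by (representatives of) elements of \mathcal A;
   T^g T^h = T^{gh} as elements of \mathcal A, i.e. mod null sets *)
Definition is_action (T : G -> X -> X) : Prop :=
  (forall g, inv_mpt mu (T g)) /\
  (forall g h, ae_equal mu (T g \o T h) (T (mul g h))) /\
  (forall A B, measurable A -> measurable B ->
     continuous (fun g => mr mu (T g @` A `&` B))).

Definition gamma_mixing (Gam : set G) (T : G -> X -> X) : Prop :=
  forall A B, measurable A -> measurable B -> forall eps : R, 0 < eps ->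
    exists C : set G, compact C /\
      forall g, Gam g -> ~ C g ->
        `| mr mu (T g @` A `&` B) - mr mu A * mr mu B | < eps.

Definition mixing_actions (Gam : set G) : set (G -> X -> X) :=
  [set T | is_action T /\ gamma_mixing Gam T].

Definition act_equiv (T S : G -> X -> X) : Prop :=
  forall g, ae_equal mu (T g) (S g).

Definition m_dist (A : nat -> set X) (I : pred nat) (K : nat -> set G)
    (Gam : set G) (T S : G -> X -> X) : R :=
  rsum (fun i => if I i then (2%:R ^- i) *
      sup [set dA mu A (T g) (S g) | g in K i] else 0)
  + sup [set aA mu A (T g) (S g) | g in Gam].
End Actions.

(* (M / eqv, dist) is a complete separable metric space *)
Definition complete_separable_metric {R : realType} {U : Type}
    (M : set U) (eqv : U -> U -> Prop) (dist : U -> U -> R) : Prop :=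
  [/\ (forall x y, M x -> M y -> 0 <= dist x y /\ (dist x y = 0 <-> eqv x y)),
      (forall x y, M x -> M y -> dist x y = dist y x),
      (forall x y z, M x -> M y -> M z -> dist x z <= dist x y + dist y z),
      (forall u : nat -> U, (forall n, M (u n)) ->
         (forall eps : R, 0 < eps -> exists N, forall p q, (N <= p)%N -> (N <= q)%N ->
            dist (u p) (u q) < eps) ->
         exists x, M x /\ (fun n => dist (u n) x) @ \oo --> (0 : R)) &
      (exists D : set U, countable D /\ D `<=` M /\
         forall x, M x -> forall eps : R, 0 < eps -> exists y, D y /\ dist x y < eps)].

(* Main.v *)
(** The measure algebra is complete, so a Cauchy sequence of transformations has
  a limit on sets, and this limit is induced by a point map because X is a
  Lebesgue space. For a Cauchy sequence of actions, the elements g at which both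
  T_n^g and T_n^{g^-1} are Cauchy form a subgroup containing every K_i, hence the
  limit exists at every g; convergence is uniform on a K_i with nonempty
  interior, so the limit action is continuous at one point and, by translation,
  everywhere. Uniform convergence of the correlations over Gamma passes mixing to
  the limit. Applied to the sequence alternating between T and S, the subgroup
  argument also shows that actions at distance zero agree.

  For separability, T^g A is left uniformly continuous in g, since T^h preserves
  the distance between T^u A and A. Up to a given error T is thus described by
  finitely many data: a neighborhood U of e, finitely many elements h of a
  countable dense set such that the hU cover the first K_i and the compact set
  outside which the correlations over Gamma are almost products, and, for each
  h, members of the dense family approximating T^h A_i. There are countably many
  such data, and one mixing action is picked for each that occurs. *)
Require Import Defs.
From HB Require Import structures.
From mathcomp Require Import all_boot all_order all_algebra.
From mathcomp Require Import all_classical all_reals all_analysis.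
From mathcomp Require Import measurable_realfun ring lra.
Import Order.TTheory GRing.Theory Num.Theory.
Import numFieldNormedType.Exports.
Local Open Scope classical_set_scope.
Local Open Scope ring_scope.
Set Implicit Arguments. Unset Strict Implicit. Unset Printing Implicit Defensive.

(** * Weighted sums *)

(** The series in all the metrics have this form. [rsum] is meaningful only for convergent series,
    hence the uniform bound on the terms asked for in the lemmas below. *)
Definition wsum {R : realType} (u : nat -> R) : R :=
  rsum (fun i => 2%:R ^- i * u i).

Section WeightedSums.
Context {R : realType}.
Implicit Types u v : nat -> R.

Lemma weight_gt0 i : 0 < 2%:R ^- i :> R.
Proof. by rewrite invr_gt0 exprn_gt0. Qed.

Lemma weights_partial_sum n : \sum_(0 <= i < n) 2%:R ^- i <= 2 :> R.
Proof.
suff -> : \sum_(0 <= i < n) 2%:R ^- i = 2 - 2 * 2%:R ^- n :> R.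
  by rewrite gerBl mulr_ge0// ltW// weight_gt0.
elim: n => [|n IH]; first by rewrite big_nil expr0 invr1 mulr1 subrr.
rewrite big_nat_recr//= IH exprS invfM.
set w := 2%:R ^- n; lra.
Qed.

Lemma wsum_cvg u (M : R) :
  (forall i, 0 <= u i <= M) -> cvgn (series (fun i => 2%:R ^- i * u i)).
Proof.
move=> uM; have M0 : 0 <= M.
  by have /andP[a b] := uM 0%N; exact: le_trans a b.
apply: nondecreasing_is_cvgn.
  by apply: nondecreasing_series => i _; have /andP[? _] := uM i; rewrite mulr_ge0// ltW// weight_gt0.
exists (2 * M) => _ [n _ <-]; rewrite /series/=.
apply: (@le_trans _ _ (\sum_(0 <= i < n) 2%:R ^- i * M)).
  by apply: ler_sum => i _; rewrite ler_wpM2l ?(ltW (weight_gt0 _))//; case/andP: (uM i).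
by rewrite -mulr_suml ler_wpM2r// weights_partial_sum.
Qed.

Lemma wsum_le_bound u (M c : R) : (forall i, 0 <= u i <= M) ->
  (forall n, \sum_(0 <= i < n) 2%:R ^- i * u i <= c) -> wsum u <= c.
Proof.
move=> uM uc; apply: limr_le; first exact: wsum_cvg uM.
by apply: nearW => n; exact: uc.
Qed.

Lemma partial_le_wsum u (M : R) n : (forall i, 0 <= u i <= M) ->
  \sum_(0 <= i < n) 2%:R ^- i * u i <= wsum u.
Proof.
move=> uM; apply: (@nondecreasing_cvgn_le _ (series (fun i => 2%:R ^- i * u i))).
  by apply: nondecreasing_series => i _; have /andP[? _] := uM i; rewrite mulr_ge0// ltW// weight_gt0.
exact: wsum_cvg uM.
Qed.

Lemma wsum_ge0 u (M : R) : (forall i, 0 <= u i <= M) -> 0 <= wsum u.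
Proof. by move=> uM; have := partial_le_wsum 0 uM; rewrite big_nil. Qed.

Lemma wsum_le2 u (M : R) : (forall i, 0 <= u i <= M) -> wsum u <= 2 * M.
Proof.
move=> uM; apply: (wsum_le_bound uM) => n.
have M0 : 0 <= M by have /andP[a b] := uM 0%N; exact: le_trans a b.
apply: (@le_trans _ _ (\sum_(0 <= i < n) 2%:R ^- i * M)).
  by apply: ler_sum => i _; rewrite ler_wpM2l ?(ltW (weight_gt0 _))//; case/andP: (uM i).
by rewrite -mulr_suml ler_wpM2r// weights_partial_sum.
Qed.

Lemma term_le_wsum u (M : R) i : (forall i, 0 <= u i <= M) ->
  u i <= 2%:R ^+ i * wsum u.
Proof.
move=> uM; rewrite -ler_pdivrMl ?exprn_gt0//.
apply: le_trans (partial_le_wsum i.+1 uM).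
rewrite big_nat_recr//= lerDr sumr_ge0// => j _.
by have /andP[? _] := uM j; rewrite mulr_ge0// ltW// weight_gt0.
Qed.

Lemma le_wsum u v (M N : R) : (forall i, 0 <= u i <= M) ->
  (forall i, 0 <= v i <= N) -> (forall i, u i <= v i) -> wsum u <= wsum v.
Proof.
move=> uM vN uv; apply: lim_series_le; [exact: wsum_cvg uM|exact: wsum_cvg vN|].
by move=> i; rewrite ler_wpM2l ?(ltW (weight_gt0 _)).
Qed.

Lemma wsumD u v (M N : R) : (forall i, 0 <= u i <= M) ->
  (forall i, 0 <= v i <= N) -> wsum (fun i => u i + v i) = wsum u + wsum v.
Proof.
move=> uM vN; rewrite /wsum /rsum -(lim_seriesD (wsum_cvg uM) (wsum_cvg vN)).
by congr (limn (series _)); apply/funext => i; rewrite mulrDr.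
Qed.

Lemma weight_small (c eps : R) : 0 < eps -> exists k, c * 2%:R ^- k < eps.
Proof.
move=> eps0; have /cvgrPdist_lt/(_ eps eps0)[k _ Hk] :
    (fun n => c * 2%:R ^- n) @ \oo --> (0 : R).
  rewrite -[X in _ --> X](mulr0 c); apply: cvgMr.
  rewrite (_ : (fun n => 2%:R ^- n : R) = (fun n => 2^-1 ^+ n)).
    by apply: cvg_expr; rewrite ger0_norm// invf_lt1// ltr1n.
  by apply/funext => n; rewrite exprVn.
exists k; have := Hk k (leqnn k); rewrite /= sub0r normrN.
by apply: le_lt_trans; rewrite ler_norm.
Qed.

(** The terms from [L] on contribute at most [2 * M * 2 ^- L] and the first [L] at most [2 * eps].
    Since [L] and [eps] depend only on [M] and [eta], smallness of the metrics reduces to finitely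
    many terms, uniformly in the transformations. *)
Lemma wsum_small (M eta : R) : 0 < eta -> exists L, exists2 eps : R, 0 < eps &
  forall u, (forall i, 0 <= u i <= M) -> (forall i, (i < L)%N -> u i <= eps) ->
    wsum u <= eta.
Proof.
move=> eta0.
have [L HL] : exists L, 2 * M * 2%:R ^- L <= eta / 2 :> R.
  have [L HL] := weight_small (2 * M) (divr_gt0 eta0 (ltr0n R 2)).
  by exists L; exact: ltW.
exists L, (eta / 4); first by rewrite divr_gt0.
move=> u uM uL; apply: (wsum_le_bound uM) => n.
have M0 : 0 <= M by have /andP[a b] := uM 0%N; exact: le_trans a b.
(* Extending the sum to [L + n] terms allows the split at [L] for every [n]. *)
apply: (@le_trans _ _ (\sum_(0 <= i < L + n) 2%:R ^- i * u i)).
  rewrite [X in _ <= X](@big_cat_nat _ _ _ n)//= ?leq_addl// lerDl sumr_ge0// => j _.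
  by have /andP[? _] := uM j; rewrite mulr_ge0// ltW// weight_gt0.
rewrite (@big_cat_nat _ _ _ L)//= ?leq_addr//.
have h1 : \sum_(0 <= i < L) 2%:R ^- i * u i <= 2 * (eta / 4).
  apply: (@le_trans _ _ (\sum_(0 <= i < L) 2%:R ^- i * (eta / 4))).
    rewrite !big_mkord; apply: ler_sum => i _.
    by rewrite ler_wpM2l ?(ltW (weight_gt0 _))// uL.
  by rewrite -mulr_suml ler_wpM2r ?weights_partial_sum// divr_ge0// ltW.
have h2 : \sum_(L <= i < L + n) 2%:R ^- i * u i <= 2 * M * 2%:R ^- L.
  rewrite -{1}[L]add0n big_addn addKn.
  apply: (@le_trans _ _ (\sum_(0 <= i < n) 2%:R ^- i * (M * 2%:R ^- L))).
    apply: ler_sum => i _; rewrite exprD invfM -mulrA ler_wpM2l ?(ltW (weight_gt0 _))//.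
    by rewrite mulrC ler_wpM2r ?(ltW (weight_gt0 _))//; case/andP: (uM (i + L)%N).
  rewrite -mulr_suml -mulrA ler_wpM2r ?weights_partial_sum//.
  by rewrite mulr_ge0// ltW// weight_gt0.
lra.
Qed.

End WeightedSums.

(** * The measure algebra *)

Section MeasureAlgebra.
Context {R : realType} {d : measure_display} {X : measurableType d}
  (mu : probability X R).
Implicit Types A B C E : set X.

Local Notation mr := (mr mu).
Local Notation D A B := (mr (symdiff A B)).

Lemma mrE A : measurable A -> mu A = (mr A)%:E.
Proof. by move=> mA; rewrite /Defs.mr fineK// fin_num_measure. Qed.

Lemma mr_ge0 A : 0 <= mr A.
Proof. exact/fine_ge0/measure_ge0. Qed.

Lemma mr_le1 A : measurable A -> mr A <= 1.
Proof. by move=> mA; rewrite -lee_fin -mrE// probability_le1. Qed.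

Lemma le_mr A B : measurable A -> measurable B -> A `<=` B -> mr A <= mr B.
Proof. by move=> mA mB AB; rewrite -lee_fin -!mrE// le_measure ?inE. Qed.

Lemma mr0 : mr set0 = 0.
Proof. by rewrite /Defs.mr measure0. Qed.

Lemma mrT : mr setT = 1.
Proof. by rewrite /Defs.mr probability_setT. Qed.

Lemma mrU A B : measurable A -> measurable B -> mr (A `|` B) <= mr A + mr B.
Proof.
move=> mA mB; rewrite -lee_fin EFinD -!mrE//; last exact: measurableU.
exact: measureU2.
Qed.

Lemma mrDI A B : measurable A -> measurable B ->
  mr A = mr (A `\` B) + mr (A `&` B).
Proof.
move=> mA mB; apply: EFin_inj; rewrite EFinD -!mrE//.
- exact: measureDI.
- exact: measurableI.
- exact: measurableD.
Qed.

Lemma mrC A : measurable A -> mr (~` A) = 1 - mr A.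
Proof.
move=> mA; have := mrDI measurableT mA; rewrite mrT setTI setTD => ->.
by rewrite addrK.
Qed.

Lemma measurable_symdiff A B : measurable A -> measurable B ->
  measurable (symdiff A B).
Proof. by move=> mA mB; apply: measurableU; exact: measurableD. Qed.

Lemma symdiffC A B : symdiff A B = symdiff B A.
Proof. by rewrite /symdiff setUC. Qed.

Lemma symdiff_setC A B : symdiff (~` A) (~` B) = symdiff A B.
Proof. by rewrite /symdiff !setDE !setCK setUC [B `&` _]setIC [A `&` _]setIC setUC. Qed.

Lemma symdiffxx A : symdiff A A = set0.
Proof. by rewrite /symdiff setDv setU0. Qed.

Lemma symdiff_set0 A : symdiff A set0 = A.
Proof. by rewrite /symdiff setD0 set0D setU0. Qed.

Lemma symdiff_trans A B C : symdiff A C `<=` symdiff A B `|` symdiff B C.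
Proof. by rewrite /symdiff => x /=; have [] := pselect (B x); tauto. Qed.

Lemma symdiff_setI A B C E :
  symdiff (A `&` B) (C `&` E) `<=` symdiff A C `|` symdiff B E.
Proof. by rewrite /symdiff => x /=; have [] := pselect (C x); have [] := pselect (B x); tauto. Qed.

Lemma dist_tri B A C : measurable A -> measurable B -> measurable C ->
  D A C <= D A B + D B C.
Proof.
move=> mA mB mC; apply: le_trans (mrU _ _); [|exact: measurable_symdiff..].
by apply: le_mr; [|apply: measurableU|exact: symdiff_trans]; exact: measurable_symdiff.
Qed.

Lemma dist_setI A B C E : measurable A -> measurable B -> measurable C ->
  measurable E -> D (A `&` B) (C `&` E) <= D A C + D B E.
Proof.
move=> mA mB mC mE; apply: le_trans (mrU _ _); [|exact: measurable_symdiff..].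
apply: le_mr; [|apply: measurableU|exact: symdiff_setI]; apply: measurable_symdiff => //;
  exact: measurableI.
Qed.

Lemma dist_mr A B : measurable A -> measurable B -> `|mr A - mr B| <= D A B.
Proof.
move=> mA mB; have H A' B' : measurable A' -> measurable B' -> mr A' - mr B' <= D A' B'.
  move=> mA' mB'; rewrite lerBlDl; apply: le_trans (mrU mB' (measurable_symdiff mA' mB')).
  apply: le_mr => //; first by apply: measurableU => //; exact: measurable_symdiff.
  by rewrite /symdiff => x /=; have [] := pselect (B' x); tauto.
by rewrite ler_norml lerNl opprB H//= symdiffC H.
Qed.

(** The remainders decrease to the empty set, so continuity of the measure from above applies. *)
Lemma mr_bigcup_small (F : nat -> set X) (eps : R) :
  (forall n, measurable (F n)) -> 0 < eps ->
  exists k0, forall k, (k0 <= k)%N ->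
    mr (\bigcup_n F n `\` \bigcup_(n < k) F n) < eps.
Proof.
move=> mF eps0.
pose H k := \bigcup_n F n `\` \bigcup_(n < k) F n.
have mH k : measurable (H k).
  by apply: measurableD; apply: bigcup_measurable => *; exact: mF.
have mcap : measurable (\bigcap_k H k) by exact: bigcap_measurable.
have : (mu \o H) @ \oo --> mu (\bigcap_k H k).
  apply: nonincreasing_cvg_mu => //.
    by rewrite (le_lt_trans (probability_le1 mu (mH 0%N)))// ltry.
  move=> i j ij; apply/subsetPset; apply: setDS.
  by move=> x [k /= ki Fx]; exists k => //=; exact: leq_trans ij.
rewrite (_ : \bigcap_k H k = set0); last first.
  rewrite -subset0 => x Hx; have [[n _ Fn] _] := Hx 0%N I.
  by have [_] := Hx n.+1 I; apply; exists n => /=.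
rewrite measure0 => /fine_cvgP[_ /cvgrPdist_lt/(_ _ eps0)[k0 _ Hk]].
exists k0 => k k0k; have := Hk _ k0k; rewrite /= sub0r normrN.
by apply: le_lt_trans; rewrite ler_norm.
Qed.

Lemma mr_bigcup_ord (F : nat -> set X) k : (forall n, measurable (F n)) ->
  mr (\bigcup_(n < k) F n) <= \sum_(n < k) mr (F n).
Proof.
move=> mF; elim: k => [|k IH].
  by rewrite big_ord0 bigcup_mkord big_ord0 mr0.
rewrite big_ord_recr/= bigcup_mkord big_ord_recr/= -bigcup_mkord.
apply: le_trans (mrU _ (mF k)) _; first by apply: bigcup_measurable => *; exact: mF.
by rewrite lerD2r.
Qed.

Lemma mr_bigcup_le (F : nat -> set X) (c : R) : (forall n, measurable (F n)) ->
  (forall k, \sum_(n < k) mr (F n) <= c) -> mr (\bigcup_n F n) <= c.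
Proof.
move=> mF Fc; apply/ler_addgt0Pr => e e0.
have [k /(_ k (leqnn k)) Hk] := mr_bigcup_small mF e0.
have mk : measurable (\bigcup_(n < k) F n) by apply: bigcup_measurable.
have mT : measurable (\bigcup_n F n) by apply: bigcup_measurable.
apply: (@le_trans _ _ (mr (\bigcup_(n < k) F n) + mr (\bigcup_n F n `\` \bigcup_(n < k) F n))).
  apply: le_trans (mrU mk (measurableD mT mk)).
  apply: le_mr => //; first exact: measurableU mk (measurableD mT mk).
  by move=> x Fx; have [] := pselect ((\bigcup_(n < k) F n) x); [left|right].
apply: lerD; last exact: ltW.
exact: le_trans (mr_bigcup_ord _ mF) (Fc k).
Qed.

Lemma mr_bigcup0 (F : nat -> set X) : (forall n, measurable (F n)) ->
  (forall n, mr (F n) = 0) -> mr (\bigcup_n F n) = 0.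
Proof.
move=> mF F0; apply/eqP; rewrite eq_le mr_ge0 andbT; apply: mr_bigcup_le => // k.
by rewrite big1.
Qed.

(* The limit is the limsup of a subsequence along which the distances of
   consecutive sets are at most [2 ^ -k]. *)
Lemma set_seq_complete (B : nat -> set X) : (forall n, measurable (B n)) ->
  (forall eps : R, 0 < eps -> exists N, forall p q, (N <= p)%N -> (N <= q)%N ->
     D (B p) (B q) < eps) ->
  exists E, measurable E /\
    forall eps : R, 0 < eps -> exists N, forall p, (N <= p)%N -> D (B p) E < eps.
Proof.
move=> mB cB.
have /choice[N HN] k : exists N, forall p q, (N <= p)%N -> (N <= q)%N ->
    D (B p) (B q) < 2%:R ^- k by apply: cB; exact: weight_gt0.
pose M k := (\max_(i < k.+1) N i)%N.
have MN k i : (i <= k)%N -> (N i <= M k)%N.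
  by rewrite -ltnS => ik; apply: (leq_bigmax (Ordinal ik)).
have MM k l : (k <= l)%N -> (M k <= M l)%N.
  move=> kl; apply/bigmax_leqP => i _; apply: MN.
  by rewrite (leq_trans _ kl)// -ltnS.
pose S k := symdiff (B (M k)) (B (M k.+1)).
have mS k : measurable (S k) by exact: measurable_symdiff.
have S2 k : mr (S k) <= 2%:R ^- k.
  by apply/ltW/HN; apply: MN.
pose E := \bigcap_k \bigcup_i B (M (k + i)%N).
have mE : measurable E by apply: bigcap_measurable => // k _; apply: bigcup_measurable.
exists E; split => //.
(* Outside the later sets [S], membership in [B (M j)] no longer changes for [j >= k], so it
   coincides with membership in [E]. *)
have EB k : symdiff (B (M k)) E `<=` \bigcup_i S (k + i)%N.
  apply: contrapT => /nonsubset[x [BEx nSx]].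
  have Bx i : B (M (k + i)%N) x <-> B (M k) x.
    elim: i => [|i IH]; first by rewrite addn0.
    rewrite addnS -IH; apply: contrapT => nB; apply: nSx; exists i => //.
    by rewrite /S /symdiff/=; have [] := pselect (B (M (k + i)%N) x);
      have [] := pselect (B (M (k + i).+1) x); tauto.
  case: BEx => -[/= b1 b2].
    apply: b2 => j _; have /Bx H := b1.
    exists k => //; rewrite addnC.
    by apply/Bx.
  by apply: b2; have [i _ /Bx] := b1 k I.
have DBE k : D (B (M k)) E <= 2 * 2%:R ^- k.
  apply: (@le_trans _ _ (mr (\bigcup_i S (k + i)%N))).
    by apply: le_mr; [exact: measurable_symdiff|apply: bigcup_measurable|exact: EB].
  apply: mr_bigcup_le => // n.
  apply: (@le_trans _ _ (\sum_(0 <= i < n) 2%:R ^- i * 2%:R ^- k)).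
    rewrite big_mkord; apply: ler_sum => i _; apply: le_trans (S2 _) _.
    by rewrite exprD invfM mulrC.
  by rewrite -mulr_suml ler_wpM2r ?weights_partial_sum// ltW// weight_gt0.
move=> eps eps0.
(* The constant 3 is 2 from [DBE] plus 1 from the Cauchy bound between [B p] and [B (M k)]. *)
have [k Hk] := weight_small 3 eps0.
exists (M k) => p Mp; apply: le_lt_trans Hk.
apply: (le_trans (dist_tri (mB p) (mB (M k)) mE)).
have := HN k p (M k) (leq_trans (MN _ _ (leqnn k)) Mp) (MN _ _ (leqnn k)).
have := DBE k; set w := 2%:R ^- k; lra.
Qed.

End MeasureAlgebra.

(** * Limits of preimages *)

(** For nonnegative sequences this is convergence to zero; being one-sided, it passes to smaller
    sequences by a single comparison. *)
Definition vanish {R : realType} (u : nat -> R) :=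
  forall eps : R, 0 < eps -> exists N, forall n, (N <= n)%N -> u n < eps.

Section Vanish.
Context {R : realType}.
Implicit Types u v : nat -> R.

Lemma vanish_le v u : (forall n, u n <= v n) -> vanish v -> vanish u.
Proof.
move=> uv v0 e /v0[N HN]; exists N => n /HN; exact: le_lt_trans.
Qed.

Lemma vanishD u v : vanish u -> vanish v -> vanish (fun n => u n + v n).
Proof.
move=> u0 v0 e e0; have e20 : 0 < e / 2 by rewrite divr_gt0.
have [N HN] := u0 _ e20; have [M HM] := v0 _ e20.
exists (maxn N M) => n; rewrite geq_max => /andP[/HN a /HM b]; lra.
Qed.

Lemma vanish0 : vanish (fun=> 0 : R).
Proof. by move=> e e0; exists 0%N. Qed.

Lemma vanish_sum (u : nat -> nat -> R) k : (forall i, vanish (u i)) ->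
  vanish (fun n => \sum_(i < k) u i n).
Proof.
move=> u0; elim: k => [|k IH].
  by apply: vanish_le vanish0 => n; rewrite big_ord0.
by apply: vanish_le (vanishD IH (u0 k)) => n; rewrite big_ord_recr.
Qed.

Lemma vanish_cst (c : R) : vanish (fun=> c) -> c <= 0.
Proof.
move=> c0; rewrite leNgt; apply/negP => /c0[N /(_ N (leqnn N))].
by rewrite ltxx.
Qed.

End Vanish.

Section PreimageLimits.
Context {R : realType} {d : measure_display} {X : measurableType d}
  (mu : probability X R).
Implicit Types A B C E : set X.

Local Notation mr := (mr mu).
Local Notation D A B := (mr (symdiff A B)).

(** Weaker than [inv_mpt]: a limit map is first known only to preserve measure, and its inverse is
    found later. *)
Definition mpt (f : X -> X) := measurable_fun setT f /\
  forall B, measurable B -> mr (f @^-1` B) = mr B.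

Lemma measurable_preim {d'} {Y : measurableType d'} (f : X -> Y) (B : set Y) :
  measurable_fun setT f -> measurable B -> measurable (f @^-1` B).
Proof. by move=> mf mB; rewrite -[X in measurable X]setTI; exact: mf. Qed.

Lemma preim_symdiff (f : X -> X) A B :
  symdiff (f @^-1` A) (f @^-1` B) = f @^-1` symdiff A B.
Proof. by []. Qed.

Lemma mpt_dist f A B : mpt f -> measurable A -> measurable B ->
  D (f @^-1` A) (f @^-1` B) = D A B.
Proof.
by move=> [mf pf] mA mB; rewrite preim_symdiff pf//; exact: measurable_symdiff.
Qed.

(** Limits are taken of preimages because these commute with complements and countable unions for
    every point map. *)
Definition preim_lim (f : nat -> X -> X) (B E : set X) :=
  [/\ measurable B, measurable E & vanish (fun n => D (f n @^-1` B) E)].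

Variable f : nat -> X -> X.
Hypothesis fmpt : forall n, mpt (f n).

Let mf n B : measurable B -> measurable (f n @^-1` B).
Proof. by move=> mB; apply: measurable_preim => //; case: (fmpt n). Qed.

Lemma preim_lim_setC B E : preim_lim f B E -> preim_lim f (~` B) (~` E).
Proof.
move=> [mB mE v]; split; [exact: measurableC..|].
by apply: vanish_le v => n; rewrite -preimage_setC symdiff_setC.
Qed.

(** The tails of both unions beyond some [k] are small, and the preimage of the first tail is
    equally small for every [n] because [f n] preserves measure. The finitely many remaining sets
    are handled by [vanish_sum]. *)
Lemma preim_lim_bigcup (B E : nat -> set X) :
  (forall k, preim_lim f (B k) (E k)) ->
  preim_lim f (\bigcup_k B k) (\bigcup_k E k).
Proof.
move=> BE.
have mB k : measurable (B k) by case: (BE k).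
have mE k : measurable (E k) by case: (BE k).
have mUB : measurable (\bigcup_k B k) by exact: bigcup_measurable.
have mUE : measurable (\bigcup_k E k) by exact: bigcup_measurable.
split => // e e0; have e30 : 0 < e / 3 by rewrite divr_gt0.
have [k1 H1] := mr_bigcup_small mu mB e30.
have [k2 H2] := mr_bigcup_small mu mE e30.
pose k := maxn k1 k2.
have {}H1 := H1 k (leq_maxl _ _); have {}H2 := H2 k (leq_maxr _ _).
have [N HN] := @vanish_sum _ (fun i n => D (f n @^-1` B i) (E i)) k
  (fun i => let: And3 _ _ v := BE i in v) _ e30.
exists N => n /HN {}HN.
pose S i := symdiff (f n @^-1` B i) (E i).
have mS i : measurable (S i) by apply: measurable_symdiff => //; exact: mf.
have mUS : measurable (\bigcup_(i < k) S i) by exact: bigcup_measurable.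
have mTB : measurable (\bigcup_i B i `\` \bigcup_(i < k) B i).
  by apply: measurableD => //; exact: bigcup_measurable.
have mTE : measurable (\bigcup_i E i `\` \bigcup_(i < k) E i).
  by apply: measurableD => //; exact: bigcup_measurable.
have sub : symdiff (f n @^-1` \bigcup_i B i) (\bigcup_i E i) `<=`
    (\bigcup_(i < k) S i `|` f n @^-1` (\bigcup_i B i `\` \bigcup_(i < k) B i)) `|`
    (\bigcup_i E i `\` \bigcup_(i < k) E i).
  rewrite /symdiff => x /= [[[i _ Bi] nE]|[[i _ Ei] nB]].
    left; have [ik|ik] := ltnP i k.
      by left; exists i => //; left; split => // Ei; apply: nE; exists i.
    have [[j /= jk Bj]|nB] := pselect ((\bigcup_(i < k) B i) (f n x)).
      by left; exists j => //; left; split => // Ej; apply: nE; exists j.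
    by right; split => //; exists i.
  have [[j /= jk Ej]|nE] := pselect ((\bigcup_(i < k) E i) x).
    by left; left; exists j => //; right; split => // Bj; apply: nB; exists j.
  by right; split => //; exists i.
apply: le_lt_trans (le_mr mu _ _ sub) _.
- by apply: measurable_symdiff => //; exact: mf.
- by do 2?apply: measurableU => //; exact: mf.
apply: le_lt_trans (mrU mu _ mTE) _; first by apply: measurableU => //; exact: mf.
have h1 := mrU mu mUS (mf n mTB).
have h2 := mr_bigcup_ord mu k mS.
have h3 := (fmpt n).2 _ mTB.
move: HN h1 h2 h3 H1 H2; rewrite /S /=.
set a := mr (_ `|` _); set b := \sum_(i < _) _; set c := mr (\bigcup_(i < k) _).
set x := mr (_ @^-1` _); set y := mr (\bigcup_n B n `\` _); set z := mr (\bigcup_n E n `\` _).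
lra.
Qed.

Lemma preim_lim_dist0 B E E' : preim_lim f B E -> measurable E' -> D E E' = 0 ->
  preim_lim f B E'.
Proof.
move=> [mB mE v] mE' EE'; split => //; apply: vanish_le v => n.
by have := dist_tri mu (mf n mB) mE mE'; rewrite EE' addr0.
Qed.

Lemma preim_lim_dist0l B B' E : preim_lim f B E -> measurable B' -> D B' B = 0 ->
  preim_lim f B' E.
Proof.
move=> [mB mE v] mB' BB'; split => //; apply: vanish_le v => n.
have := dist_tri mu (mf n mB') (mf n mB) mE.
by rewrite /= mpt_dist// BB' add0r.
Qed.

Lemma preim_lim_unique B E E' : preim_lim f B E -> preim_lim f B E' -> D E E' = 0.
Proof.
move=> [mB mE v] [_ mE' v']; apply/eqP; rewrite eq_le mr_ge0 andbT.
apply/vanish_cst; apply: vanish_le (vanishD v v') => n.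
by rewrite [symdiff (f n @^-1` B) E]symdiffC; apply: dist_tri => //; exact: mf.
Qed.

Lemma preim_lim_mr B E : preim_lim f B E -> mr E = mr B.
Proof.
move=> [mB mE v]; apply/eqP; rewrite -subr_eq0 -normr_le0.
apply/vanish_cst; apply: vanish_le v => n.
by rewrite -((fmpt n).2 _ mB) distrC; apply: dist_mr => //; exact: mf.
Qed.

Lemma preim_lim_ex B : measurable B ->
  (forall eps : R, 0 < eps -> exists N, forall p q, (N <= p)%N -> (N <= q)%N ->
     D (f p @^-1` B) (f q @^-1` B) < eps) -> exists E, preim_lim f B E.
Proof.
move=> mB cB; have [E [mE HE]] := set_seq_complete (fun n => mf n mB) cB.
by exists E; split.
Qed.

End PreimageLimits.

(** * Point realizations *)

Section PointRealization.
Context {R : realType} {d : measure_display} {X : measurableType d}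
  (mu : probability X R).
Implicit Types A B C E : set X.

Local Notation mr := (mr mu).
Local Notation D A B := (mr (symdiff A B)).

(** Unions over the rationals thereby become unions over [nat], the form taken by the lemmas on
    countable unions. *)
Lemma rat_enum : exists e : nat -> option rat, forall q, exists k, e k = Some q.
Proof. by exists unpickle => q; exists (pickle q); rewrite pickleK. Qed.

Lemma mr_sub0 A B : measurable A -> measurable B -> A `<=` B -> mr B = 0 ->
  mr A = 0.
Proof. by move=> mA mB AB B0; apply/eqP; rewrite eq_le mr_ge0 andbT -B0 le_mr. Qed.

Lemma mnullE A : mnull mu A <-> measurable A /\ mr A = 0.
Proof.
split=> -[mA A0]; split => //; first by rewrite /Defs.mr A0.
by rewrite mrE// A0.
Qed.

Lemma mrU0 A B : measurable A -> measurable B -> mr A = 0 -> mr B = 0 ->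
  mr (A `|` B) = 0.
Proof.
move=> mA mB A0 B0; apply/eqP; rewrite eq_le mr_ge0 andbT.
by have := mrU mu mA mB; rewrite A0 B0 addr0.
Qed.

(* The limits of the preimages of the rays are the sublevel sets of a function
   [h]; composing it with the inverse of the isomorphism [phi] onto the unit
   interval gives the point map. *)
Lemma preim_lim_realization (f : nat -> X -> X) :
  nonatomic_lebesgue_space mu -> (forall n, mpt mu (f n)) ->
  (forall B, measurable B -> forall eps : R, 0 < eps ->
     exists N, forall p q, (N <= p)%N -> (N <= q)%N ->
     D (f p @^-1` B) (f q @^-1` B) < eps) ->
  exists F, mpt mu F /\ forall B, measurable B -> preim_lim mu f B (F @^-1` B).
Proof.
move=> [N [N' [phi [/mnullE[mN N0] [_ [_ [mphi [inj [im [mim _]]]]]]]]]] fmpt cf.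
have phi01 x : ~ N x -> 0 <= phi x <= 1.
  move=> Nx; have : (phi @` (~` N)) (phi x) by exists x.
  by rewrite im => -[/=]; rewrite in_itv.
have preim0 : preim_lim mu f set0 set0.
  split => //; apply: vanish_le vanish0 => n.
  by rewrite preimage_set0 symdiffxx mr0.
have preimT : preim_lim mu f setT setT.
  by rewrite -setC0; exact: preim_lim_setC.
have mray (t : R) : measurable (phi @^-1` `]-oo, t]) by exact: measurable_preim.
(* Choosing [E q] exactly empty for [q < 0] and full for [1 <= q] makes the set [S x] below nonempty
   and bounded below by zero for every [x], so that its infimum is meaningful. *)
have /choice[E HE] (q : rat) : exists E,
    [/\ preim_lim mu f (phi @^-1` `]-oo, ratr q]) E,
        (q < 0 -> E = set0) & (1 <= q -> E = setT)].
  have [q0|q0] := ltP q 0.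
    exists set0; split => //; last by move=> q1; have := le_lt_trans q1 q0; rewrite ltr10.
    apply: preim_lim_dist0l preim0 _ _ => //.
    rewrite symdiff_set0; apply: mr_sub0 (mN) _ N0 => //.
    move=> x /=; rewrite in_itv/= => xq; apply: contrapT => /phi01/andP[x0 _].
    by have := le_trans x0 xq; rewrite ler0q leNgt q0.
  have [q1|q1] := leP 1 q.
    exists setT; split => //.
    apply: preim_lim_dist0l preimT _ _ => //.
    rewrite -setC0 -[X in symdiff X]setCK symdiff_setC symdiff_set0.
    apply: mr_sub0 (mN) _ N0 => //; first exact: measurableC.
    move=> x /= xq; apply: contrapT => /phi01/andP[_ x1]; apply: xq.
    by rewrite in_itv/=; apply: le_trans x1 _; rewrite -(rmorph1 (@ratr R)) ler_rat.
  have [E HE] := preim_lim_ex fmpt (mray (ratr q)) (cf _ (mray _)).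
  by exists E; split.
have [en enP] := rat_enum.
pose S x := [set ratr q | q in [set q | E q x]] : set R.
pose h x := inf (S x).
have S1 x : S x 1.
  by exists 1; rewrite ?rmorph1//=; have [_ _ ->] := HE 1.
have S0 x : lbound (S x) 0.
  move=> _ [q /= Eq <-]; rewrite ler0q leNgt; apply/negP => q0.
  by have [_ H _] := HE q; move: Eq; rewrite H.
(* The strict inequality makes the sublevel sets of [h] exact countable unions of sets [E q],
   whether or not [E] is monotone in [q]. *)
have hlt x (t : R) : h x < t <-> exists2 q, E q x & ratr q < t.
  split=> [|[q Eq qt]].
    move=> /inf_lt[|y [q Eq <-] qt]; first by exists 1.
    by exists q.
  by apply: le_lt_trans qt; apply: ge_inf; [exists 0; exact: S0|exists q].
pose ray (t : R) (k : nat) : set R := if en k is Some q then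
  (if ratr q < t then `]-oo, ratr q]%classic else set0) else set0.
pose Eray (t : R) (k : nat) : set X := if en k is Some q then
  (if ratr q < t then E q else set0) else set0.
have rayE (t : R) : `]-oo, t[%classic = \bigcup_k ray t k.
  apply/seteqP; split => [x /=|x [k _]].
    rewrite in_itv/= => /rat_in_itvoo[q]; rewrite in_itv/= => /andP[xq qt].
    have [k kq] := enP q; exists k => //.
    by rewrite /ray kq qt/= in_itv/= ltW.
  rewrite /ray; case: (en _) => // q; case: ifPn => //= qt.
  by rewrite !in_itv/= => xq; exact: le_lt_trans xq qt.
have ErayE (t : R) : h @^-1` `]-oo, t[ = \bigcup_k Eray t k.
  apply/seteqP; split => [x /=|x [k _]].
    rewrite in_itv/= => /hlt[q Eq qt].
    by have [k kq] := enP q; exists k => //; rewrite /Eray kq qt.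
  rewrite /Eray; case: (en _) => // q; case: ifPn => //= qt Eq.
  by rewrite in_itv/=; apply/hlt; exists q.
(* The sets [C] whose preimages under [phi] have the preimage under [h] as limit form a
   sigma-algebra, which contains the open rays. *)
have sub : <<s @RGenInftyO.G R>> `<=`
    [set C | preim_lim mu f (phi @^-1` C) (h @^-1` C)].
  apply: smallest_sub.
    split.
    - exact: preim0.
    - by move=> B HB; rewrite setTD; exact: (preim_lim_setC HB).
    - move=> F HF; rewrite /mkset !preimage_bigcup.
      exact: (preim_lim_bigcup fmpt HF).
  move=> _ [t ->] /=; rewrite ErayE rayE preimage_bigcup.
  apply: preim_lim_bigcup => // k; rewrite /ray /Eray.
  case: (en k) => [q|]; last by rewrite preimage_set0.
  by case: ifPn; [case: (HE q)|rewrite preimage_set0].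
have hlim (C : set R) : measurable C ->
    preim_lim mu f (phi @^-1` C) (h @^-1` C).
  move=> mC; apply: sub; have := mC.
  by rewrite [X in X C -> _](RGenInftyO.measurableE R).
(* [T x] is the point outside [N] that [phi] sends to [h x]. Where there is none, the value [x] is a
   default; this happens only on a measurable null set. *)
pose T x := if pselect (exists y, ~ N y /\ phi y = h x) is left p
  then projT1 (cid p) else x.
have mP B : measurable B -> measurable (phi @` (B `\` N)).
  by move=> mB; apply: mim => [|x []//]; exact: measurableD.
have mhP B : measurable B -> measurable (h @^-1` (phi @` (B `\` N))).
  by move=> mB; case: (hlim _ (mP _ mB)).
have TE B : T @^-1` B = (h @^-1` (phi @` (B `\` N))) `|`
    (B `&` ~` (h @^-1` (phi @` (setT `\` N)))).
  apply/seteqP; split => x /=; rewrite /T; case: pselect => [p|np].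
  - case: (cid p) => /= y [Ny yx] By; left; exists y => //.
  - by move=> Bx; right; split => // -[y [_ Ny] yx]; apply: np; exists y.
  - case: (cid p) => /= y [Ny yx] [|[_ []]]; last by exists y.
    move=> [z [Bz Nz] zx]; rewrite (_ : y = z)//.
    by apply: inj; rewrite ?inE// yx zx.
  - by move=> [[y [By Ny] yx]|[//]]; exfalso; apply: np; exists y.
have phiP B : symdiff B (phi @^-1` (phi @` (B `\` N))) `<=` N.
  rewrite /symdiff => x /= [[Bx nP]|[[y [By Ny] yx] Bx]]; apply: contrapT => Nx.
    by apply: nP; exists x.
  by apply: Bx; rewrite -(_ : y = x)//; apply: inj; rewrite ?inE.
have mT B : measurable B -> measurable (T @^-1` B).
  move=> mB; rewrite TE; apply: measurableU; first exact: mhP.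
  by apply: measurableI => //; apply: measurableC; exact: mhP.
have Tlim B : measurable B -> preim_lim mu f B (T @^-1` B).
  move=> mB; have mpP B' : measurable B' -> measurable (phi @^-1` (phi @` (B' `\` N))).
    by move=> mB'; apply: measurable_preim => //; exact: mP.
  apply: (preim_lim_dist0l fmpt (B := phi @^-1` (phi @` (B `\` N)))) => //; last first.
    by apply: mr_sub0 (mN) (phiP _) N0; apply: measurable_symdiff => //; exact: mpP.
  apply: (preim_lim_dist0 fmpt (hlim _ (mP _ mB))); first exact: mT.
  (* The default set is null: its complement is the limit of preimages of a set that differs from
     the whole space by a part of [N], and limits keep the measure. *)
  apply: (@mr_sub0 _ (~` (h @^-1` (phi @` (setT `\` N))))).
  - by apply: measurable_symdiff; [exact: mhP|exact: mT].
  - by apply: measurableC; exact: mhP.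
  - by rewrite TE /symdiff => x /=; tauto.
  - rewrite mrC; last exact: mhP.
    rewrite (preim_lim_mr fmpt (hlim _ (mP _ measurableT))).
    rewrite -(mrT mu) (mrDI mu measurableT (mpP _ measurableT)) setTI addrK.
    apply: mr_sub0 (mN) _ N0; first by apply: measurableD => //; exact: mpP.
    by move=> x [_ Px]; apply: (phiP setT); left.
exists T; split => //; split; first by move=> _ B mB; rewrite setTI; exact: mT.
by move=> B mB; exact: (preim_lim_mr fmpt (Tlim _ mB)).
Qed.

(** Since [phi] is injective off [N] and rational rays separate real numbers, the points where [f]
    and [g] differ lie in the preimages of [N] and in countably many null sets, one for each ray. *)
Lemma ae_equal_preim (f g : X -> X) : nonatomic_lebesgue_space mu ->
  mpt mu f -> mpt mu g ->
  (forall B, measurable B -> D (f @^-1` B) (g @^-1` B) = 0) -> ae_equal mu f g.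
Proof.
move=> [N [N' [phi [/mnullE[mN N0] [_ [_ [mphi [inj _]]]]]]]] [mf pf] [mg pg] fg.
have [en enP] := rat_enum.
pose C q := phi @^-1` `]-oo, ratr q] : set X.
have mC q : measurable (C q) by exact: measurable_preim.
pose S k := if en k is Some q then symdiff (f @^-1` C q) (g @^-1` C q)
  else set0.
have mS k : measurable (S k).
  by rewrite /S; case: (en _) => // q; apply: measurable_symdiff; exact: measurable_preim.
have mUS : measurable (\bigcup_k S k) by exact: bigcup_measurable.
have mfN : measurable (f @^-1` N) by exact: measurable_preim.
have mgN : measurable (g @^-1` N) by exact: measurable_preim.
exists ((f @^-1` N `|` g @^-1` N) `|` \bigcup_k S k); split.
  apply/mnullE; split; first by do 2?apply: measurableU.
  apply: mrU0 => //; first exact: measurableU.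
    by apply: mrU0; rewrite ?pf ?pg.
  apply: mr_bigcup0 => // k; rewrite /S; case: (en _) => [q|]; last exact: mr0.
  exact: fg.
move=> x nx; apply: inj; rewrite ?inE; [by move=> Nx; apply: nx; left; left|
  by move=> Nx; apply: nx; left; right|].
have Cfg q : phi (f x) <= ratr q <-> phi (g x) <= ratr q.
  have [k kq] := enP q; have : ~ S k x by move=> Sx; apply: nx; right; exists k.
  rewrite /S kq /symdiff /C/= !in_itv/=.
  by move=> H; split=> a; apply: contrapT => b; apply: H; [left|right].
apply/eqP; rewrite eq_le; apply/andP; split; rewrite leNgt; apply/negP => /rat_in_itvoo[q].
  rewrite in_itv/= => /andP[qg qf].
  by have := (Cfg q).2 (ltW qg); rewrite leNgt qf.
rewrite in_itv/= => /andP[qg qf].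
by have := (Cfg q).1 (ltW qg); rewrite leNgt qf.
Qed.

(* Both maps are changed to the identity on the union of all preimages, under
   words in the two maps, of the null set where they fail to be inverse. *)
Lemma ae_inverse_realization (F F' : X -> X) : mpt mu F -> mpt mu F' ->
  ae_equal mu (F \o F') id -> ae_equal mu (F' \o F) id ->
  exists T, inv_mpt mu T /\ ae_equal mu T F.
Proof.
move=> [mF pF] [mF' pF'] [N1 [/mnullE[mN1 N10] H1]] [N2 [/mnullE[mN2 N20] H2]].
pose E := fix E k := if k is k'.+1 then E k' `|` (F @^-1` E k' `|` F' @^-1` E k')
  else N1 `|` N2.
have EP k : measurable (E k) /\ mr (E k) = 0.
  elim: k => [|k [mE E0]]; first by split; [exact: measurableU|exact: mrU0].
  have m1 : measurable (F @^-1` E k) by exact: measurable_preim.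
  have m2 : measurable (F' @^-1` E k) by exact: measurable_preim.
  split; first by do 2?apply: measurableU.
  by apply: mrU0 => //; [exact: measurableU|apply: mrU0; rewrite ?pF ?pF'].
pose N := \bigcup_k E k.
have mN : measurable N by apply: bigcup_measurable => k _; case: (EP k).
have N0 : mr N = 0 by apply: mr_bigcup0 => k; case: (EP k).
have NF x : ~ N x -> ~ N (F x).
  by move=> nx [k _ Ek]; apply: nx; exists k.+1 => //=; right; left.
have NF' x : ~ N x -> ~ N (F' x).
  by move=> nx [k _ Ek]; apply: nx; exists k.+1 => //=; right; right.
have FF' x : ~ N x -> F (F' x) = x.
  by move=> nx; apply: H1 => N1x; apply: nx; exists 0%N => //=; left.
have F'F x : ~ N x -> F' (F x) = x.
  by move=> nx; apply: H2 => N1x; apply: nx; exists 0%N => //=; right.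
pose mod (H : X -> X) x := if pselect (N x) then x else H x.
have modE H B : mod H @^-1` B = (N `&` B) `|` (~` N `&` H @^-1` B).
  apply/seteqP; split => x; rewrite /mod /=; case: pselect => //=; tauto.
have mmod H : measurable_fun setT H -> measurable_fun setT (mod H).
  move=> mH _ B mB; rewrite setTI modE; apply: measurableU; first exact: measurableI.
  by apply: measurableI; [exact: measurableC|exact: measurable_preim].
exists (mod F); split; last first.
  by exists N; split; [exact/mnullE|move=> x; rewrite /mod; case: pselect].
have can1 H H' : (forall x, ~ N x -> ~ N (H x)) ->
    (forall x, ~ N x -> H' (H x) = x) -> cancel (mod H) (mod H').
  move=> NH H'H x; rewrite /mod; case: (pselect (N x)) => nx; case: pselect => //.
    by move=> NHx; case: (NH _ nx NHx).
  by rewrite H'H.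
split; first exact: mmod.
split; first by exists (mod F'); split; [exact: can1|split; [exact: can1|exact: mmod]].
move=> B mB; have mp (H : X -> X) : measurable_fun setT H -> measurable (H @^-1` B).
  by move=> mH; exact: measurable_preim.
rewrite !mrE//; last by apply: mp; exact: mmod.
congr (_%:E); rewrite -(pF _ mB); apply/eqP; rewrite -subr_eq0 -normr_le0.
apply: le_trans (dist_mr mu _ _) _; [by apply: mp; exact: mmod|exact: mp|].
rewrite (@mr_sub0 _ N)//; first by apply: measurable_symdiff; apply: mp => //; exact: mmod.
by rewrite modE /symdiff => x /= Hx; apply: contrapT; tauto.
Qed.

End PointRealization.

(** * The metrics *)

Section TransformationMetrics.
Context {R : realType} {d : measure_display} {X : measurableType d}
  (mu : probability X R).
Implicit Types (B C E : set X) (f g h : X -> X).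

Local Notation mr := (mr mu).
Local Notation D A B := (mr (symdiff A B)).

Lemma inv_mpt_mpt f : inv_mpt mu f -> mpt mu f.
Proof. by move=> [mf [_ pf]]; split => // B mB; rewrite /Defs.mr pf. Qed.

(** Images under [f] become preimages under [f'], for which measurability and invariance of the
    measure are at hand. *)
Lemma inv_mpt_inv f : inv_mpt mu f -> exists f',
  [/\ inv_mpt mu f', cancel f f', cancel f' f & forall B, f @` B = f' @^-1` B].
Proof.
move=> [mf [[f' [ff' [f'f mf']]] pf]]; exists f'.
have fE B : f @` B = f' @^-1` B.
  by apply/seteqP; split=> [_ [x Bx <-]|x Bx] /=; [rewrite ff'|exists (f' x)].
split => //; split => //; split; first by exists f.
move=> B mB; rewrite -(pf (f' @^-1` B)); last exact: measurable_preim.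
by congr (mu _); apply/funext => x; rewrite /= ff'.
Qed.

Lemma measurable_im f B : inv_mpt mu f -> measurable B -> measurable (f @` B).
Proof.
by move=> /inv_mpt_inv[f' [[mf' _] _ _ ->]] mB; exact: measurable_preim.
Qed.

Lemma mr_im f B : inv_mpt mu f -> measurable B -> mr (f @` B) = mr B.
Proof.
by move=> /inv_mpt_inv[f' [/inv_mpt_mpt[_ pf'] _ _ ->]] mB; rewrite pf'.
Qed.

Lemma measurable_pre f B : inv_mpt mu f -> measurable B -> measurable (f @^-1` B).
Proof. by move=> [mf _] mB; exact: measurable_preim. Qed.

Lemma im_dist f B C : inv_mpt mu f -> measurable B -> measurable C ->
  D (f @` B) (f @` C) = D B C.
Proof.
move=> /inv_mpt_inv[f' [/inv_mpt_mpt mf' _ _ fE]] mB mC.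
by rewrite /= !fE mpt_dist.
Qed.

Lemma inv_mpt_comp f g : inv_mpt mu f -> inv_mpt mu g -> inv_mpt mu (f \o g).
Proof.
move=> [mf [[f' [ff' [f'f mf']]] pf]] [mg [[g' [gg' [g'g mg']]] pg]].
split; first exact: measurableT_comp.
split.
  exists (g' \o f'); split; first by move=> x /=; rewrite ff' gg'.
  by split; [move=> x /=; rewrite g'g f'f|exact: measurableT_comp].
by move=> B mB; rewrite comp_preimage pg ?pf//; exact: measurable_preim.
Qed.

Lemma ae_equal_im f g B : inv_mpt mu f -> inv_mpt mu g -> ae_equal mu f g ->
  measurable B -> D (f @` B) (g @` B) = 0.
Proof.
move=> If Ig [N [/mnullE[mN N0] fg]] mB.
apply: (@mr_sub0 _ _ _ _ _ (f @` N `|` g @` N)).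
- by apply: measurable_symdiff; exact: measurable_im.
- by apply: measurableU; exact: measurable_im.
- move=> y; rewrite /symdiff /= => -[[[x Bx <-] ny]|[[x Bx <-] ny]].
    left; exists x => //; apply: contrapT => /fg fgx; apply: ny.
    by exists x.
  right; exists x => //; apply: contrapT => /fg fgx; apply: ny.
  by exists x.
- by apply: mrU0; rewrite ?mr_im//; exact: measurable_im.
Qed.

Lemma ae_equal_preim_dist f g B : inv_mpt mu f -> inv_mpt mu g ->
  ae_equal mu f g -> measurable B -> D (f @^-1` B) (g @^-1` B) = 0.
Proof.
move=> If Ig [N [/mnullE[mN N0] fg]] mB.
apply: mr_sub0 mN _ N0.
  by apply: measurable_symdiff; exact: measurable_pre.
move=> x; rewrite /symdiff /= => H; apply: contrapT => /fg fgx.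
by rewrite fgx in H; tauto.
Qed.

Lemma dist_congr B B' C C' : measurable B -> measurable B' -> measurable C ->
  measurable C' -> D B B' = 0 -> D C C' = 0 -> D B C = D B' C'.
Proof.
move=> mB mB' mC mC' BB' CC'; apply/eqP; rewrite eq_le; apply/andP; split.
  have := dist_tri mu mB mB' mC; have := dist_tri mu mB' mC' mC.
  by rewrite BB' (symdiffC C' C) CC' addr0 add0r => h1 h2; exact: le_trans h2 h1.
have := dist_tri mu mB' mB mC'; have := dist_tri mu mB mC mC'.
by rewrite (symdiffC B' B) BB' CC' addr0 add0r => h1 h2; exact: le_trans h2 h1.
Qed.

Lemma mr_setI_congr B B' C : measurable B -> measurable B' -> measurable C ->
  D B B' = 0 -> mr (B `&` C) = mr (B' `&` C).
Proof.
move=> mB mB' mC BB'; apply/eqP; rewrite -subr_eq0 -normr_le0.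
apply: le_trans (dist_mr mu _ _) _; [exact: measurableI..|].
by have := dist_setI mu mB mC mB' mC; rewrite BB' add0r symdiffxx mr0.
Qed.

Lemma dist_bound B C : measurable B -> measurable C -> 0 <= D B C <= 1.
Proof. by move=> mB mC; rewrite mr_ge0 mr_le1//; exact: measurable_symdiff. Qed.

Variable A : nat -> set X.
Hypothesis mA : forall i, measurable (A i).
Local Notation dA := (dA mu A).
Local Notation aA := (aA mu A).

Definition im_term f g i := D (f @` A i) (g @` A i).
Definition pre_term f g i := D (f @^-1` A i) (g @^-1` A i).
Definition corr_term f g i j :=
  `|mr (f @` A i `&` A j) - mr (g @` A i `&` A j)|.

Lemma dAE f g : dA f g = wsum (fun i => im_term f g i + pre_term f g i).
Proof. by []. Qed.

Lemma dA_bound f g : inv_mpt mu f -> inv_mpt mu g ->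
  forall i, 0 <= im_term f g i + pre_term f g i <= 2.
Proof.
move=> If Ig i.
have /andP[a b] := dist_bound (measurable_im If (mA i)) (measurable_im Ig (mA i)).
have /andP[a' b'] := dist_bound (measurable_pre If (mA i)) (measurable_pre Ig (mA i)).
by rewrite addr_ge0//= -[2]/(1 + 1) lerD.
Qed.

Lemma corr_bound f g : inv_mpt mu f -> inv_mpt mu g ->
  forall i j, 0 <= corr_term f g i j <= 1.
Proof.
move=> If Ig i j; rewrite normr_ge0/=.
have mf := measurableI _ _ (measurable_im If (mA i)) (mA j).
have mg := measurableI _ _ (measurable_im Ig (mA i)) (mA j).
apply: le_trans (dist_mr mu mf mg) _.
by have /andP[] := dist_bound mf mg.
Qed.

Lemma corr_wsum_bound f g : inv_mpt mu f -> inv_mpt mu g ->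
  forall i, 0 <= wsum (corr_term f g i) <= 2 * 1.
Proof.
move=> If Ig i; have b := corr_bound If Ig i.
by rewrite (wsum_ge0 b) (wsum_le2 b).
Qed.

(** The weight of a pair factors, so the double series is an iterated [wsum]; moving the outer
    weight out of the inner series relies on its convergence. *)
Lemma aAE f g : inv_mpt mu f -> inv_mpt mu g ->
  aA f g = wsum (fun i => wsum (corr_term f g i)).
Proof.
move=> If Ig; rewrite /Defs.aA /wsum; congr rsum; apply/funext => i.
rewrite /rsum -[RHS](lim_seriesZ _ (wsum_cvg (corr_bound If Ig i))).
by congr (limn (series _)); apply/funext => j; rewrite exprD invfM -mulrA.
Qed.

Lemma dA_ge0 f g : inv_mpt mu f -> inv_mpt mu g -> 0 <= dA f g <= 4.
Proof.
move=> If Ig; have b := dA_bound If Ig; rewrite dAE (wsum_ge0 b)/=.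
by apply: le_trans (wsum_le2 b) _; rewrite -natrM.
Qed.

Lemma aA_ge0 f g : inv_mpt mu f -> inv_mpt mu g -> 0 <= aA f g <= 4.
Proof.
move=> If Ig; have b := corr_wsum_bound If Ig; rewrite aAE// (wsum_ge0 b)/=.
by apply: le_trans (wsum_le2 b) _; rewrite mulr1 -natrM.
Qed.

Lemma dA_sym f g : dA f g = dA g f.
Proof.
rewrite !dAE; congr wsum; apply/funext => i.
by rewrite /im_term /pre_term symdiffC [X in _ + mr X]symdiffC.
Qed.

Lemma aA_sym f g : inv_mpt mu f -> inv_mpt mu g -> aA f g = aA g f.
Proof.
move=> If Ig; rewrite !aAE//; congr wsum; apply/funext => i; congr wsum.
by apply/funext => j; rewrite /corr_term distrC.
Qed.

Lemma dA_tri f g h : inv_mpt mu f -> inv_mpt mu g -> inv_mpt mu h ->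
  dA f h <= dA f g + dA g h.
Proof.
move=> If Ig Ih; rewrite !dAE -(wsumD (dA_bound If Ig) (dA_bound Ig Ih)).
apply: (le_wsum (dA_bound If Ih) (N := 2 + 2)) => i.
  have /andP[? ?] := dA_bound If Ig i; have /andP[? ?] := dA_bound Ig Ih i.
  by rewrite addr_ge0//= lerD.
have h1 := dist_tri mu (measurable_im If (mA i)) (measurable_im Ig (mA i))
  (measurable_im Ih (mA i)).
have h2 := dist_tri mu (measurable_pre If (mA i)) (measurable_pre Ig (mA i))
  (measurable_pre Ih (mA i)).
by rewrite /im_term /pre_term addrACA lerD.
Qed.

Lemma aA_tri f g h : inv_mpt mu f -> inv_mpt mu g -> inv_mpt mu h ->
  aA f h <= aA f g + aA g h.
Proof.
move=> If Ig Ih; rewrite !aAE//.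
rewrite -(wsumD (corr_wsum_bound If Ig) (corr_wsum_bound Ig Ih)).
apply: (le_wsum (corr_wsum_bound If Ih) (N := 4)) => i.
  have /andP[? ?] := corr_wsum_bound If Ig i.
  have /andP[? ?] := corr_wsum_bound Ig Ih i.
  by rewrite addr_ge0//= (_ : 4 = 2 * 1 + 2 * 1) ?lerD// mulr1 -natrD.
rewrite -(wsumD (corr_bound If Ig i) (corr_bound Ig Ih i)).
apply: (le_wsum (corr_bound If Ih i) (N := 2)) => j.
  have /andP[? ?] := corr_bound If Ig i j.
  have /andP[? ?] := corr_bound Ig Ih i j.
  by rewrite addr_ge0//= -[2]/(1 + 1) lerD.
exact: ler_distD.
Qed.

Lemma im_le_dA f g i : inv_mpt mu f -> inv_mpt mu g ->
  D (f @` A i) (g @` A i) <= 2 ^+ i * dA f g.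
Proof.
move=> If Ig; apply: le_trans (term_le_wsum i (dA_bound If Ig)).
by rewrite /im_term lerDl mr_ge0.
Qed.

Lemma pre_le_dA f g i : inv_mpt mu f -> inv_mpt mu g ->
  D (f @^-1` A i) (g @^-1` A i) <= 2 ^+ i * dA f g.
Proof.
move=> If Ig; apply: le_trans (term_le_wsum i (dA_bound If Ig)).
by rewrite /pre_term lerDr mr_ge0.
Qed.

Lemma corr_le_aA f g i j : inv_mpt mu f -> inv_mpt mu g ->
  `|mr (f @` A i `&` A j) - mr (g @` A i `&` A j)| <= 2 ^+ j * (2 ^+ i * aA f g).
Proof.
move=> If Ig; apply: le_trans (term_le_wsum j (corr_bound If Ig i)) _.
rewrite ler_wpM2l ?exprn_ge0// aAE//.
exact: term_le_wsum (corr_wsum_bound If Ig).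
Qed.

(** A converse to [im_le_dA] and [pre_le_dA]: finitely many sets [A i] control [dA], uniformly in
    [f] and [g]. *)
Lemma dA_small (eta : R) : 0 < eta -> exists L, exists2 eps : R, 0 < eps &
  forall f g, inv_mpt mu f -> inv_mpt mu g ->
    (forall i, (i < L)%N -> D (f @` A i) (g @` A i) <= eps /\
      D (f @^-1` A i) (g @^-1` A i) <= eps) -> dA f g <= eta.
Proof.
move=> /(@wsum_small _ 2)[L [eps eps0 H]]; exists L, (eps / 2); first by rewrite divr_gt0.
move=> f g If Ig fg; apply: H => [|i /fg[a b]]; first exact: dA_bound.
by move: a b; rewrite /im_term /pre_term => a b; rewrite [leRHS]splitr lerD.
Qed.

Lemma aA_small (eta : R) : 0 < eta -> exists L, exists2 eps : R, 0 < eps &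
  forall f g, inv_mpt mu f -> inv_mpt mu g ->
    (forall i j, (i < L)%N -> (j < L)%N ->
     `|mr (f @` A i `&` A j) - mr (g @` A i `&` A j)| <= eps) -> aA f g <= eta.
Proof.
move=> /(@wsum_small _ (2 * 1))[L1 [eps1 eps10 H1]].
(* The tolerance [eps1] of the outer sum is the target for each inner sum. *)
have [L2 [eps eps0 H2]] := @wsum_small _ 1 eps1 eps10.
exists (maxn L1 L2), eps => // f g If Ig fg; rewrite aAE//.
apply: H1 => [|i iL]; first exact: corr_wsum_bound.
apply: H2 => [|j jL]; first exact: corr_bound.
by apply: fg; rewrite leq_max ?iL ?jL ?orbT.
Qed.

End TransformationMetrics.

(** * Suprema and the distance [m_dist] between families of transformations *)

Section SupImage.
Context {R : realType} {T : Type}.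
Implicit Types (K : set T) (F : T -> R).

Lemma sup_im_ge K F (M : R) g : (forall g, K g -> F g <= M) -> K g ->
  F g <= sup [set F g | g in K].
Proof.
move=> FM Kg; apply: ub_le_sup; last by exists g.
by exists M => _ [h Kh <-]; exact: FM.
Qed.

Lemma sup_im_le K F (c : R) : K !=set0 -> (forall g, K g -> F g <= c) ->
  sup [set F g | g in K] <= c.
Proof.
move=> [g Kg] Fc; apply: ge_sup; first by exists (F g), g.
by move=> _ [h Kh <-]; exact: Fc.
Qed.

End SupImage.

Section ActionMetric.
Context {R : realType} {d : measure_display} {X : measurableType d}
  (mu : probability X R) {G : topologicalType} (A : nat -> set X)
  (I : pred nat) (K : nat -> set G) (Gam : set G).
Hypothesis mA : forall i, measurable (A i).
Hypothesis K0 : forall i, I i -> K i !=set0.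
Hypothesis Gam0 : Gam !=set0.
Implicit Types T S U : G -> X -> X.

Definition all_inv_mpt T := forall g, inv_mpt mu (T g).

Local Notation dA := (dA mu A).
Local Notation aA := (aA mu A).
Local Notation m_dist := (m_dist mu A I K Gam).

Let dsup T S i := if I i then sup [set dA (T g) (S g) | g in K i] else 0.
Let asup T S := sup [set aA (T g) (S g) | g in Gam].

Lemma m_distE T S : m_dist T S = wsum (dsup T S) + asup T S.
Proof.
rewrite /Defs.m_dist /wsum; congr (rsum _ + _); apply/funext => i.
by rewrite /dsup; case: ifP; rewrite ?mulr0.
Qed.

Lemma dsup_le T S i g : all_inv_mpt T -> all_inv_mpt S -> I i -> K i g ->
  dA (T g) (S g) <= dsup T S i.
Proof.
move=> IT IS Ii Kg; rewrite /dsup Ii.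
apply: (@sup_im_ge _ _ _ (fun g => dA (T g) (S g)) 4) => // h _.
by have /andP[] := dA_ge0 mA (IT h) (IS h).
Qed.

Lemma asup_le T S g : all_inv_mpt T -> all_inv_mpt S -> Gam g ->
  aA (T g) (S g) <= asup T S.
Proof.
move=> IT IS Gg; apply: (@sup_im_ge _ _ _ (fun g => aA (T g) (S g)) 4) => // h _.
by have /andP[] := aA_ge0 mA (IT h) (IS h).
Qed.

Lemma dsup_bound T S : all_inv_mpt T -> all_inv_mpt S ->
  forall i, 0 <= dsup T S i <= 4.
Proof.
move=> IT IS i; have [Ii|nI] := boolP (I i); last by rewrite /dsup (negbTE nI) lexx/=.
apply/andP; split.
  have [g Kg] := K0 Ii; apply: le_trans (dsup_le IT IS Ii Kg).
  by have /andP[] := dA_ge0 mA (IT g) (IS g).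
rewrite /dsup Ii; apply: sup_im_le => [|g _]; first exact: K0.
by have /andP[] := dA_ge0 mA (IT g) (IS g).
Qed.

Lemma asup_ge0 T S : all_inv_mpt T -> all_inv_mpt S -> 0 <= asup T S.
Proof.
move=> IT IS; have [g Gg] := Gam0; apply: le_trans (asup_le IT IS Gg).
by have /andP[] := aA_ge0 mA (IT g) (IS g).
Qed.

Lemma m_dist_ge0 T S : all_inv_mpt T -> all_inv_mpt S -> 0 <= m_dist T S.
Proof.
move=> IT IS; rewrite m_distE addr_ge0 ?asup_ge0//.
exact: wsum_ge0 (dsup_bound IT IS).
Qed.

Lemma m_dist_sym T S : all_inv_mpt T -> all_inv_mpt S -> m_dist T S = m_dist S T.
Proof.
move=> IT IS; rewrite !m_distE; congr (wsum _ + sup _).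
  apply/funext => i; rewrite /dsup; case: ifP => // _; congr sup.
  by apply: eq_imagel => g _; exact: dA_sym.
by apply: eq_imagel => g _; exact: aA_sym.
Qed.

Lemma m_dist_tri T S U : all_inv_mpt T -> all_inv_mpt S -> all_inv_mpt U ->
  m_dist T U <= m_dist T S + m_dist S U.
Proof.
move=> IT IS IU; rewrite !m_distE addrACA; apply: lerD.
  rewrite -(wsumD (dsup_bound IT IS) (dsup_bound IS IU)).
  apply: (le_wsum (dsup_bound IT IU) (N := 4 + 4)) => i.
    have /andP[? ?] := dsup_bound IT IS i; have /andP[? ?] := dsup_bound IS IU i.
    by rewrite addr_ge0//= lerD.
  have [Ii|nI] := boolP (I i); last by rewrite /dsup (negbTE nI) addr0.
  rewrite {1}/dsup Ii; apply: sup_im_le => [|g Kg]; first exact: K0.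
  by apply: le_trans (dA_tri mA (IT g) (IS g) (IU g)) _; rewrite lerD// dsup_le.
apply: sup_im_le => // g Gg.
by apply: le_trans (aA_tri mA (IT g) (IS g) (IU g)) _; rewrite lerD// asup_le.
Qed.

Lemma dA_le_m_dist T S i g : all_inv_mpt T -> all_inv_mpt S -> I i -> K i g ->
  dA (T g) (S g) <= 2 ^+ i * m_dist T S.
Proof.
move=> IT IS Ii Kg; apply: le_trans (dsup_le IT IS Ii Kg) _.
apply: le_trans (term_le_wsum i (dsup_bound IT IS)) _.
by rewrite ler_wpM2l ?exprn_ge0// m_distE lerDl asup_ge0.
Qed.

Lemma aA_le_m_dist T S g : all_inv_mpt T -> all_inv_mpt S -> Gam g ->
  aA (T g) (S g) <= m_dist T S.
Proof.
move=> IT IS Gg; apply: le_trans (asup_le IT IS Gg) _.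
by rewrite m_distE lerDr; exact: wsum_ge0 (dsup_bound IT IS).
Qed.

Lemma m_dist_small (eta : R) : 0 < eta -> exists L, exists2 eps : R, 0 < eps &
  forall T S, all_inv_mpt T -> all_inv_mpt S ->
    (forall i g, (i < L)%N -> I i -> K i g -> dA (T g) (S g) <= eps) ->
    (forall g, Gam g -> aA (T g) (S g) <= eps) -> m_dist T S <= eta.
Proof.
move=> eta0; have eta20 : 0 < eta / 2 by rewrite divr_gt0.
have [L [eps eps0 H]] := @wsum_small _ 4 _ eta20.
(* [eps] serves the weighted sum over the [K i], and [eta / 2] the supremum over [Gam]. *)
exists L, (Num.min eps (eta / 2)); first by rewrite lt_min eps0.
move=> T S IT IS HK HG; rewrite m_distE [leRHS]splitr; apply: lerD.
  apply: H => [|i iL]; first exact: dsup_bound.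
  have [Ii|nI] := boolP (I i); last by rewrite /dsup (negbTE nI) ltW.
  rewrite /dsup Ii; apply: sup_im_le => [|g Kg]; first exact: K0.
  by have := HK i g iL Ii Kg; rewrite le_min => /andP[].
apply: sup_im_le => // g Gg.
by have := HG g Gg; rewrite le_min => /andP[].
Qed.

End ActionMetric.

(** * Actions *)

Section GroupLaws.
Context {G : topologicalType} {mul : G -> G -> G} {inv : G -> G} {e : G}.
Hypothesis Hgrp : lc_group mul inv e.

Lemma gmulA x y z : mul x (mul y z) = mul (mul x y) z.
Proof. by have [[-> _ _ _ _] _] := Hgrp. Qed.

Lemma gmule x : mul x e = x.
Proof. by have [[_ /(_ x)[_ ->] _ _ _] _] := Hgrp. Qed.

Lemma gemul x : mul e x = x.
Proof. by have [[_ /(_ x)[-> _] _ _ _] _] := Hgrp. Qed.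

Lemma gmulV x : mul x (inv x) = e.
Proof. by have [[_ _ /(_ x)[_ ->] _ _] _] := Hgrp. Qed.

Lemma gVmul x : mul (inv x) x = e.
Proof. by have [[_ _ /(_ x)[-> _] _ _] _] := Hgrp. Qed.

Lemma gmulK x y : mul (inv x) (mul x y) = y.
Proof. by rewrite gmulA gVmul gemul. Qed.

Lemma gmulVK x y : mul x (mul (inv x) y) = y.
Proof. by rewrite gmulA gmulV gemul. Qed.

Lemma ginv_unique x y : mul x y = e -> inv x = y.
Proof. by move=> xy; rewrite -(gmulK x y) xy gmule. Qed.

Lemma ginvK x : inv (inv x) = x.
Proof. by apply: ginv_unique; exact: gVmul. Qed.

Lemma ginve : inv e = e.
Proof. by apply: ginv_unique; exact: gemul. Qed.

Lemma ginvM x y : inv (mul x y) = mul (inv y) (inv x).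
Proof. by apply: ginv_unique; rewrite -gmulA gmulVK gmulV. Qed.

Lemma gmull_continuous x : continuous (mul x).
Proof.
have [[_ _ _ cm _] _] := Hgrp => y.
have := @continuous2_cvg _ _ _ _ _ _ (fun=> x) id mul x y (cm (x, y)).
by apply; [exact: cvg_cst|exact: cvg_id].
Qed.

Lemma gmulr_continuous x : continuous (mul^~ x).
Proof.
have [[_ _ _ cm _] _] := Hgrp => y.
have := @continuous2_cvg _ _ _ _ _ _ id (fun=> x) mul y x (cm (y, x)).
by apply; [exact: cvg_id|exact: cvg_cst].
Qed.

Lemma ginv_continuous : continuous inv.
Proof. by have [[_ _ _ _ ]] := Hgrp. Qed.

End GroupLaws.

(** * Group actions without continuity, and convergence on a generating set *)

Section Preactions.
Context {R : realType} {d : measure_display} {X : measurableType d}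
  (mu : probability X R) {G : topologicalType} {mul : G -> G -> G}
  {inv : G -> G} {e : G} (A : nat -> set X).
Hypothesis Hgrp : lc_group mul inv e.
Hypothesis mA : forall i, measurable (A i).
Hypothesis denseA : forall B, measurable B -> forall eps : R, 0 < eps ->
  exists i, mr mu (symdiff (A i) B) < eps.
Implicit Types (B C E : set X) (T S : G -> X -> X).

Local Notation mr := (mr mu).
Local Notation D A B := (mr (symdiff A B)).

(** The limit of a sequence of actions is first built in this sense; its continuity in the group
    element is proved afterwards. *)
Definition preaction T := all_inv_mpt mu T /\
  forall g h, ae_equal mu (T g \o T h) (T (mul g h)).

Lemma im_preim_can f B : inv_mpt mu f -> f @` (f @^-1` B) = B.
Proof.
move=> /inv_mpt_inv[f' [_ ff' f'f ->]]; apply/funext => x.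
by rewrite /preimage /= f'f.
Qed.

Lemma act_mul T g h B : preaction T -> measurable B ->
  D (T (mul g h) @` B) (T g @` (T h @` B)) = 0.
Proof.
move=> [IT HT] mB; rewrite /= image_comp symdiffC.
by apply: ae_equal_im => //; exact: inv_mpt_comp.
Qed.

(** Since [e] is idempotent, [T e] agrees with its square up to null sets, and one factor cancels
    because [T e] preserves distances. *)
Lemma act_e T B : preaction T -> measurable B -> D (T e @` B) B = 0.
Proof.
move=> HT mB; rewrite /= -(im_dist (HT.1 e))//; last first.
  exact: measurable_im (HT.1 e) mB.
by rewrite symdiffC -{1}(gmule Hgrp e) act_mul.
Qed.

Lemma act_inv T g B : preaction T -> measurable B ->
  D (T (inv g) @` B) (T g @^-1` B) = 0.
Proof.
move=> HT mB; have m1 := measurable_im (HT.1 (inv g)) mB.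
have m2 := measurable_pre (HT.1 g) mB.
rewrite /= -(im_dist (HT.1 g))// im_preim_can; last exact: HT.1.
have m3 := measurable_im (HT.1 g) m1.
have m4 := measurable_im (HT.1 e) mB.
apply/eqP; rewrite eq_le mr_ge0 andbT.
apply: le_trans (dist_tri mu m3 m4 mB) _.
by rewrite act_e// symdiffC -(gmulV Hgrp g) act_mul// addr0.
Qed.

(** The preimage half of [dA] at [g] thus carries information on images at [inv g], which the
    subgroup argument requires. *)
Lemma dist_preim_act T S g B : preaction T -> preaction S -> measurable B ->
  D (T g @^-1` B) (S g @^-1` B) = D (T (inv g) @` B) (S (inv g) @` B).
Proof.
move=> HT HS mB; apply: dist_congr; rewrite 1?[symdiff (_ @^-1` _) _]symdiffC ?act_inv//;
  by [apply: measurable_pre => //; case: HT|apply: measurable_pre => //; case: HS|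
      apply: measurable_im => //; case: HT|apply: measurable_im => //; case: HS].
Qed.

Lemma im_dist_approx f g B i : inv_mpt mu f -> inv_mpt mu g -> measurable B ->
  D (f @` B) (g @` B) <= 2 * D (A i) B + D (f @` A i) (g @` A i).
Proof.
move=> If Ig mB.
have m1 := measurable_im If mB; have m2 := measurable_im If (mA i).
have m3 := measurable_im Ig (mA i); have m4 := measurable_im Ig mB.
have h1 := dist_tri mu m1 m2 m4; have h2 := dist_tri mu m2 m3 m4.
move: h1 h2; rewrite /= (im_dist If mB (mA i)) (im_dist Ig (mA i) mB) (symdiffC B).
lra.
Qed.

Definition im_cauchy (u : nat -> G -> X -> X) g B := forall eps : R, 0 < eps ->
  exists N, forall p q, (N <= p)%N -> (N <= q)%N ->
    D (u p g @` B) (u q g @` B) < eps.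

Lemma im_cauchy_dense u g B : (forall n, all_inv_mpt mu (u n)) ->
  (forall i, im_cauchy u g (A i)) -> measurable B -> im_cauchy u g B.
Proof.
move=> Iu cu mB eps eps0; have e40 : 0 < eps / 4 by rewrite divr_gt0.
have [i Ai] := denseA mB e40; have [N HN] := cu i _ e40.
exists N => p q Np Nq.
have := im_dist_approx i (Iu p g) (Iu q g) mB; have := HN p q Np Nq.
move: Ai => /=; lra.
Qed.

(** The image of [B] under [u p h] varies with [p], so it is replaced by the fixed image at stage
    [N1], to which the Cauchy property at [g] applies. The error of the replacement is not enlarged
    because [u p g] preserves distances. *)
Lemma im_cauchy_mul u g h : (forall n, preaction (u n)) ->
  (forall B, measurable B -> im_cauchy u g B) ->
  (forall B, measurable B -> im_cauchy u h B) ->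
  forall B, measurable B -> im_cauchy u (mul g h) B.
Proof.
move=> Hu cg ch B mB eps eps0; have e30 : 0 < eps / 3 by rewrite divr_gt0.
have mim n k C : measurable C -> measurable (u n k @` C).
  by move=> mC; exact: measurable_im ((Hu n).1 k) mC.
have [N1 H1] := ch B mB _ e30.
have [N2 H2] := cg _ (mim N1 h _ mB) _ e30.
exists (maxn N1 N2) => p q; rewrite !geq_max => /andP[p1 p2] /andP[q1 q2].
have m1 := mim p h B mB; have m2 := mim q h B mB; have m3 := mim N1 h B mB.
have -> : D (u p (mul g h) @` B) (u q (mul g h) @` B) =
    D (u p g @` (u p h @` B)) (u q g @` (u q h @` B)).
  apply: dist_congr (act_mul _ _ (Hu p) mB) (act_mul _ _ (Hu q) mB);
    [exact: mim|exact: mim m1|exact: mim|exact: mim m2].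
have h1 := dist_tri mu (mim p g _ m1) (mim p g _ m3) (mim q g _ m2).
have h2 := dist_tri mu (mim p g _ m3) (mim q g _ m3) (mim q g _ m2).
have := H1 p N1 p1 (leqnn _); have := H1 N1 q (leqnn _) q1.
have := H2 p q p2 q2.
move: h1 h2 => /=; rewrite (im_dist ((Hu p).1 g) m1 m3) (im_dist ((Hu q).1 g) m3 m2).
lra.
Qed.

(* The elements at which the sequence converges form a subgroup. *)
Lemma im_cauchy_everywhere (I : pred nat) (K : nat -> set G) (SG : set G) u :
  SG `<=` \bigcup_(i in [set i | I i]) K i -> generates_group mul inv e SG ->
  (forall n, preaction (u n)) ->
  (forall i g, I i -> K i g -> forall k, im_cauchy u g (A k)) ->
  (forall i g, I i -> K i g -> forall k, im_cauchy u (inv g) (A k)) ->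
  forall g B, measurable B -> im_cauchy u g B.
Proof.
move=> SK gen Hu cK cKV.
have Iu n : all_inv_mpt mu (u n) by case: (Hu n).
(* Asking for convergence at both [g] and [inv g] makes closure under inverses immediate. *)
pose H := [set g | (forall B, measurable B -> im_cauchy u g B) /\
  (forall B, measurable B -> im_cauchy u (inv g) B)].
suff HT : H = setT.
  move=> g B mB; have : H g by rewrite HT.
  by case=> + _; apply.
have ce B : measurable B -> im_cauchy u e B.
  move=> mB eps eps0; exists 0%N => p q _ _.
  rewrite (_ : D _ _ = D B B); first by rewrite /= symdiffxx mr0.
  by apply: dist_congr; rewrite ?act_e//; apply: measurable_im => //; exact: Iu.
apply: gen; first split.
- by split => //; rewrite (ginve Hgrp).
- split=> [x y [cx cVx] [cy cVy]|x [cx cVx]].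
    by split; rewrite ?(ginvM Hgrp); exact: im_cauchy_mul.
  by split; rewrite ?(ginvK Hgrp).
- move=> g /SK[i /= Ii Kg]; split => B mB; apply: im_cauchy_dense => //.
    exact: cK Ii Kg.
  exact: cKV Ii Kg.
Qed.

Variables (I : pred nat) (K : nat -> set G) (Gam : set G).
Hypothesis K0 : forall i, I i -> K i !=set0.
Hypothesis Gam0 : Gam !=set0.
Hypothesis genK : exists SG : set G, SG `<=` \bigcup_(i in [set i | I i]) K i /\
  generates_group mul inv e SG.
Local Notation m_dist := (m_dist mu A I K Gam).

Lemma m_dist_ae_equal T S : all_inv_mpt mu T -> all_inv_mpt mu S ->
  act_equiv mu T S -> m_dist T S = 0.
Proof.
move=> IT IS TS; apply/eqP; rewrite eq_le m_dist_ge0// andbT.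
apply/ler_addgt0Pr => eta eta0; rewrite add0r.
have [L [eps eps0 H]] := m_dist_small mu mA K0 Gam0 eta0.
apply: H => // [i|] g.
  move=> _ _ _; have [L' [eps' eps'0 H']] := dA_small mu mA eps0.
  apply: H' => // j _; rewrite ae_equal_im// ae_equal_preim_dist//.
  by split; exact: ltW.
move=> _; have [L' [eps' eps'0 H']] := aA_small mu mA eps0.
apply: H' => // j k _ _.
rewrite (@mr_setI_congr _ _ _ _ _ (S g @` A j)) ?ae_equal_im ?subrr ?normr0 1?ltW//;
  exact: measurable_im.
Qed.

(** Distance zero compares [T] and [S] only on the sets [K i]. There the alternating sequence is
    Cauchy, and [im_cauchy_everywhere] carries this to the whole group. *)
Lemma ae_equal_m_dist T S : nonatomic_lebesgue_space mu ->
  preaction T -> preaction S -> m_dist T S = 0 -> act_equiv mu T S.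
Proof.
move=> Leb HT HS TS0.
have [IT _] := HT; have [IS _] := HS.
pose u n := if odd n then T else S.
have Hu n : preaction (u n) by rewrite /u; case: odd.
have [SG [SK gen]] := genK.
have K_eq i g k : I i -> K i g -> D (T g @` A k) (S g @` A k) <= 0 /\
    D (T g @^-1` A k) (S g @^-1` A k) <= 0.
  move=> Ii Kg; have dA0 : dA mu A (T g) (S g) <= 0.
    apply: le_trans (dA_le_m_dist mA K0 Gam0 IT IS Ii Kg) _.
    by rewrite TS0 mulr0.
  split; [apply: le_trans (im_le_dA mA _ (IT g) (IS g)) _|
          apply: le_trans (pre_le_dA mA _ (IT g) (IS g)) _];
    by rewrite pmulr_rle0// exprn_gt0.
have cau g B : D (T g @` B) (S g @` B) <= 0 -> im_cauchy u g B.
  move=> TS eps eps0; exists 0%N => p q _ _; rewrite /u.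
  case: odd; case: odd; rewrite ?symdiffxx ?mr0//; first exact: le_lt_trans TS _.
  by rewrite symdiffC; exact: le_lt_trans TS _.
have cu := im_cauchy_everywhere SK gen Hu
  (fun i g Ii Kg k => cau g (A k) (K_eq i g k Ii Kg).1).
have {}cu g B : measurable B -> im_cauchy u g B.
  apply: cu => i {}g Ii Kg k; apply: cau.
  by rewrite -dist_preim_act//; case: (K_eq i g k Ii Kg).
move=> g; apply: ae_equal_preim => //; [exact: inv_mpt_mpt..|].
move=> B mB; rewrite dist_preim_act//; apply/eqP; rewrite eq_le mr_ge0 andbT.
apply/ler_addgt0Pr => eps /(cu (inv g) B mB)[N HN]; rewrite add0r.
(* The indices [N.*2.+1] and [N.*2] are odd and even, so the Cauchy estimate between them compares
   [T] with [S]. *)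
have N2 : (N <= N.*2)%N by rewrite -addnn leq_addr.
by have := HN N.*2.+1 N.*2 (leqW N2) N2; rewrite /u /= odd_double /= => /ltW.
Qed.

End Preactions.

(** * Completeness *)

Section ActionLimits.
Context {R : realType} {d : measure_display} {X : measurableType d}
  (mu : probability X R) {G : topologicalType} {mul : G -> G -> G}
  {inv : G -> G} {e : G}.
Hypothesis Hgrp : lc_group mul inv e.
Hypothesis Leb : nonatomic_lebesgue_space mu.
Implicit Types (B C E : set X) (T S : G -> X -> X).

Local Notation mr := (mr mu).
Local Notation D A B := (mr (symdiff A B)).
Local Notation preaction := (preaction mu (mul := mul)).

Lemma ae_equal_trans (f g h : X -> X) :
  ae_equal mu f g -> ae_equal mu g h -> ae_equal mu f h.
Proof.
move=> [N [/mnullE[mN N0] fg]] [M [/mnullE[mM M0] gh]]; exists (N `|` M); split.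
  by apply/mnullE; split; [exact: measurableU|exact: mrU0].
by move=> x /= NM; rewrite fg ?gh// => ?; apply: NM; [right|left].
Qed.

Lemma mpt_comp (f g : X -> X) : mpt mu f -> mpt mu g -> mpt mu (f \o g).
Proof.
move=> [mf pf] [mg pg]; split; first exact: measurableT_comp.
by move=> B mB; rewrite comp_preimage pg ?pf//; exact: measurable_preim.
Qed.

Variable u : nat -> G -> X -> X.
Hypothesis Hu : forall n, preaction (u n).

Let umpt g n : mpt mu (u n g).
Proof. by apply: inv_mpt_mpt; case: (Hu n). Qed.

Definition pointwise_preim_lim T := forall g B, measurable B ->
  preim_lim mu (u^~ g) B (T g @^-1` B).

(** The preimage of [B] under [u n g] moves with [n]; it can be replaced by its limit inside the
    preimage under [u n h], which preserves distances. *)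
Lemma preim_lim_mul T : (forall g, mpt mu (T g)) -> pointwise_preim_lim T ->
  forall g h, ae_equal mu (T g \o T h) (T (mul g h)).
Proof.
move=> Tmpt Tlim g h; apply: ae_equal_preim => //; first exact: mpt_comp.
move=> B mB; apply: (preim_lim_unique (umpt (mul g h)) (B := B)); last exact: Tlim.
have [_ mgB vg] := Tlim g B mB; have [_ mhB vh] := Tlim h _ mgB.
split => //; apply: vanish_le (vanishD vg vh) => n.
have mu1 : measurable (u n g @^-1` B) by apply: measurable_preim => //; case: (umpt g n).
have mh C : measurable C -> measurable (u n h @^-1` C).
  by move=> mC; apply: measurable_preim => //; case: (umpt h n).
have mgh : measurable (u n (mul g h) @^-1` B).
  by apply: measurable_preim => //; case: (umpt (mul g h) n).
have -> : D (u n (mul g h) @^-1` B) ((T g \o T h) @^-1` B) =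
    D (u n h @^-1` (u n g @^-1` B)) (T h @^-1` (T g @^-1` B)).
  apply: dist_congr; [exact: mgh|exact: mh|exact: mhB|exact: mhB| |];
    last by rewrite symdiffxx mr0.
  rewrite symdiffC -comp_preimage; apply: ae_equal_preim_dist => //.
  - by apply: inv_mpt_comp; case: (Hu n).
  - by case: (Hu n).
  - by case: (Hu n).
apply: le_trans (dist_tri mu (mh _ mu1) (mh _ mgB) mhB) _.
by rewrite mpt_dist.
Qed.

(** Each [g] receives a limit map by [preim_lim_realization]. By multiplicativity the maps at [g]
    and [inv g] are inverse to each other almost everywhere, so [ae_inverse_realization] supplies
    invertible representatives. *)
Lemma preaction_limit :
  (forall g B, measurable B -> im_cauchy mu u g B) ->
  exists T, preaction T /\
    forall g B, measurable B -> vanish (fun n => D (u n g @` B) (T g @` B)).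
Proof.
move=> cu.
have /choice[F HF] g : exists F, mpt mu F /\
    forall B, measurable B -> preim_lim mu (u^~ g) B (F @^-1` B).
  apply: preim_lim_realization => // B mB eps /(cu (inv g) B mB)[N HN].
  by exists N => p q Np Nq; rewrite (dist_preim_act Hgrp)//; exact: HN.
have Fmpt g : mpt mu (F g) by case: (HF g).
have Flim : pointwise_preim_lim F by move=> g; case: (HF g).
have Fmul := preim_lim_mul Fmpt Flim.
have Fe : ae_equal mu (F e) id.
  apply: ae_equal_preim => // B mB.
  apply: (preim_lim_unique (umpt e) (B := B)); first exact: Flim.
  split => //; apply: vanish_le vanish0 => n.
  have mp := measurable_preim (umpt e n).1 mB.
  have mi := measurable_im ((Hu n).1 (inv e)) mB.
  rewrite (@dist_congr _ _ _ _ _ (u n (inv e) @` B) _ B)//.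
  - by rewrite (ginve Hgrp) (act_e Hgrp).
  - by rewrite symdiffC (act_inv Hgrp).
  - by rewrite symdiffxx mr0.
have /choice[T HT] g : exists f, inv_mpt mu f /\ ae_equal mu f (F g).
  apply: (ae_inverse_realization (Fmpt g) (Fmpt (inv g))).
    by apply: ae_equal_trans (Fmul _ _) _; rewrite (gmulV Hgrp).
  by apply: ae_equal_trans (Fmul _ _) _; rewrite (gVmul Hgrp).
have Tinv g : inv_mpt mu (T g) by case: (HT g).
have TF g B : measurable B -> D (F g @^-1` B) (T g @^-1` B) = 0.
  move=> mB; have [_ [N [/mnullE[mN N0] TF]]] := HT g.
  apply: mr_sub0 mN _ N0.
    by apply: measurable_symdiff; [exact: measurable_preim (Fmpt g).1 mB|exact: measurable_pre].
  move=> x; rewrite /symdiff /= => H; apply: contrapT => /TF E.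
  by rewrite E in H; tauto.
have Tlim : pointwise_preim_lim T.
  move=> g B mB; apply: (preim_lim_dist0 (umpt g) (Flim g B mB)) => //.
    exact: measurable_pre.
  exact: TF.
have Tact : preaction T.
  by split => //; apply: preim_lim_mul => // g; exact: inv_mpt_mpt.
exists T; split => // g B mB; have [_ _ v] := Tlim (inv g) B mB.
by apply: vanish_le v => n; rewrite (dist_preim_act Hgrp)// (ginvK Hgrp).
Qed.

End ActionLimits.

(** * Continuity of a limit of actions *)

Section ActionContinuity.
Context {R : realType} {d : measure_display} {X : measurableType d}
  (mu : probability X R) {G : topologicalType} {mul : G -> G -> G}
  {inv : G -> G} {e : G}.
Hypothesis Hgrp : lc_group mul inv e.
Implicit Types (B C E : set X) (T S : G -> X -> X).

Local Notation mr := (mr mu).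
Local Notation D A B := (mr (symdiff A B)).
Local Notation preaction := (preaction mu (mul := mul)).

(** Applying the measure-preserving [T c] with [c = mul k0 (inv g0)] turns the correlation of [B]
    and [C] at [g] into that of [B] and the image of [C] under [T c] at [mul c g], and [mul c g]
    tends to [k0] as [g] tends to [g0]. *)
Lemma act_continuous_point T (k0 : G) : preaction T ->
  (forall B C, measurable B -> measurable C ->
     {for k0, continuous (fun g => mr (T g @` B `&` C))}) ->
  forall B C, measurable B -> measurable C ->
     continuous (fun g => mr (T g @` B `&` C)).
Proof.
move=> HT Hk B C mB mC g0; have IT := HT.1.
pose c := mul k0 (inv g0).
have mcC : measurable (T c @` C) by exact: measurable_im.
pose psi k := mr (T k @` B `&` T c @` C).
have phiE : (fun g => mr (T g @` B `&` C)) = psi \o mul c.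
  apply/funext => g; have mgB := measurable_im (IT g) mB.
  have mcgB := measurable_im (IT c) mgB.
  rewrite /psi /= (@mr_setI_congr _ _ _ _ (T (mul c g) @` B) (T c @` (T g @` B)))//.
  - rewrite -(mr_im (IT c)); last exact: measurableI.
    have [f' [_ _ _ fE]] := inv_mpt_inv (IT c).
    by rewrite !fE preimage_setI.
  - exact: measurable_im.
  - exact: (act_mul c g HT mB).
rewrite phiE; apply: continuous_comp; first exact: (gmull_continuous Hgrp).
rewrite /c -(gmulA Hgrp) (gVmul Hgrp) (gmule Hgrp).
exact: Hk.
Qed.

Lemma act_continuous_limit (u : nat -> G -> X -> X) T (K : set G) (k0 : G) :
  (forall n, is_action mu mul (u n)) -> preaction T -> nbhs k0 K ->
  (forall B, measurable B -> forall eps : R, 0 < eps -> exists N, forall g, K g ->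
     D (u N g @` B) (T g @` B) < eps) ->
  forall B C, measurable B -> measurable C ->
     continuous (fun g => mr (T g @` B `&` C)).
Proof.
move=> Hu HT K0 unif; apply: (@act_continuous_point _ k0) => // B C mB mC.
apply/cvgrPdist_lt => eps eps0; have e30 : 0 < eps / 3 by rewrite divr_gt0.
have [N HN] := unif B mB _ e30.
have close g : K g -> `|mr (u N g @` B `&` C) - mr (T g @` B `&` C)| < eps / 3.
  move=> Kg; apply: le_lt_trans (HN g Kg).
  have m1 := measurable_im ((Hu N).1 g) mB; have m2 := measurable_im (HT.1 g) mB.
  apply: le_trans (dist_mr mu _ _) _; [exact: measurableI..|].
  by have := dist_setI mu m1 mC m2 mC; rewrite symdiffxx mr0 addr0.
have [_ [_ cont]] := Hu N.
have /cvgrPdist_lt/(_ _ e30) near1 := cont B C mB mC k0.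
have ck0 := close _ (nbhs_singleton K0).
near=> g.
have Kg : K g by near: g.
have := close g Kg; have : `|mr (u N k0 @` B `&` C) - mr (u N g @` B `&` C)| < eps / 3.
  by near: g.
move: ck0; rewrite !ltr_norml => /andP[a b] /andP[a' b'] /andP[a'' b''].
by apply/andP; split; lra.
Unshelve. all: by end_near. Qed.

End ActionContinuity.

(** * Limits of Cauchy sequences of mixing actions *)

Section Completeness.
Context {R : realType} {d : measure_display} {X : measurableType d}
  (mu : probability X R) {G : topologicalType} {mul : G -> G -> G}
  {inv : G -> G} {e : G} (A : nat -> set X)
  (I : pred nat) (K : nat -> set G) (Gam : set G).
Hypothesis Hgrp : lc_group mul inv e.
Hypothesis Leb : nonatomic_lebesgue_space mu.
Hypothesis mA : forall i, measurable (A i).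
Hypothesis denseA : forall B, measurable B -> forall eps : R, 0 < eps ->
  exists i, mr mu (symdiff (A i) B) < eps.
Hypothesis K0 : forall i, I i -> interior (K i) !=set0.
Hypothesis genK : exists SG : set G, SG `<=` \bigcup_(i in [set i | I i]) K i /\
  generates_group mul inv e SG.
Hypothesis unbG : unbounded Gam.
Implicit Types (B C E : set X) (T S : G -> X -> X).

Local Notation mr := (mr mu).
Local Notation D A B := (mr (symdiff A B)).
Local Notation dA := (dA mu A).
Local Notation aA := (aA mu A).
Local Notation m_dist := (m_dist mu A I K Gam).
Local Notation M := (mixing_actions mu mul Gam).

Lemma unbounded_nonempty : Gam !=set0.
Proof.
apply: contrapT => G0; apply: (unbG compact0) => g Gg.
by apply: G0; exists g.
Qed.

(** With no index the generating set would be empty and the group trivial, hence compact, against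
    the unboundedness of [Gam]. *)
Lemma index_nonempty : exists i, I i.
Proof.
have [SG [SK gen]] := genK; apply: contrapT => nI.
have subE : subgroup mul inv e [set e].
  split; first by [].
  split=> [x y -> ->|x ->] /=; first exact: gmule Hgrp e.
  exact: (ginve Hgrp).
have ET : [set e] = setT.
  by apply: gen => // g /SK[i Ii _]; exfalso; apply: nI; exists i.
by apply: (unbG (@compact_set1 _ e)); rewrite ET.
Qed.

Lemma K_nonempty i : I i -> K i !=set0.
Proof. by move=> /K0[g /interior_subset Kg]; exists g. Qed.

Lemma dA_vanish (f : nat -> X -> X) (h : X -> X) :
  (forall n, inv_mpt mu (f n)) -> inv_mpt mu h ->
  (forall B, measurable B -> vanish (fun n => D (f n @` B) (h @` B))) ->
  (forall B, measurable B -> vanish (fun n => D (f n @^-1` B) (h @^-1` B))) ->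
  vanish (fun n => dA (f n) h).
Proof.
move=> If Ih vi vp eps eps0; have e20 : 0 < eps / 2 by rewrite divr_gt0.
have [L [del del0 H]] := dA_small mu mA e20.
(* As its terms are nonnegative, one vanishing sum bounds all the first [L] terms at once. *)
have v : vanish (fun n => \sum_(i < L) (D (f n @` A i) (h @` A i) +
    D (f n @^-1` A i) (h @^-1` A i))).
  apply: (@vanish_sum _ (fun i n => D (f n @` A i) (h @` A i) +
    D (f n @^-1` A i) (h @^-1` A i))) => i.
  by apply: vanishD; [exact: vi|exact: vp].
have [N HN] := v _ del0; exists N => n /HN Hn.
apply: (@le_lt_trans _ _ (eps / 2)); last lra.
apply: H => // i iL; move: Hn; rewrite (bigD1 (Ordinal iL))//=.
set r := \sum_(_ < _ | _) _ => Hn.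
have r0 : 0 <= r by apply: sumr_ge0 => j _; rewrite addr_ge0// mr_ge0.
have := mr_ge0 mu (symdiff (f n @` A i) (h @` A i)).
have := mr_ge0 mu (symdiff (f n @^-1` A i) (h @^-1` A i)).
by move: Hn => /=; lra.
Qed.

Lemma corr_le_dist (f h : X -> X) i j : inv_mpt mu f -> inv_mpt mu h ->
  `|mr (f @` A i `&` A j) - mr (h @` A i `&` A j)| <= D (f @` A i) (h @` A i).
Proof.
move=> If Ih; have mf := measurable_im If (mA i); have mh := measurable_im Ih (mA i).
apply: le_trans (dist_mr mu _ _) _; [exact: measurableI..|].
by have := dist_setI mu mf (mA j) mh (mA j); rewrite symdiffxx mr0 addr0.
Qed.

Lemma aA_vanish (f : nat -> X -> X) (h : X -> X) :
  (forall n, inv_mpt mu (f n)) -> inv_mpt mu h ->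
  (forall B, measurable B -> vanish (fun n => D (f n @` B) (h @` B))) ->
  vanish (fun n => aA (f n) h).
Proof.
move=> If Ih vi eps eps0; have e20 : 0 < eps / 2 by rewrite divr_gt0.
have [L [del del0 H]] := aA_small mu mA e20.
have v : vanish (fun n => \sum_(i < L) D (f n @` A i) (h @` A i)).
  by apply: (@vanish_sum _ (fun i n => D (f n @` A i) (h @` A i))) => i; exact: vi.
have [N HN] := v _ del0; exists N => n /HN Hn.
apply: (@le_lt_trans _ _ (eps / 2)); last lra.
apply: H => // i j iL jL; apply: le_trans (corr_le_dist _ _ (If n) Ih) _.
move: Hn; rewrite (bigD1 (Ordinal iL))//=.
set r := \sum_(_ < _ | _) _ => Hn.
have r0 : 0 <= r by apply: sumr_ge0 => k _; exact: mr_ge0.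
by move: Hn => /=; lra.
Qed.

(** Passing from [A i], [A j] to [B], [C] changes the correlation and the product of measures by at
    most [D (A i) B + D (A j) C] each. With the mixing error this makes five terms, hence
    [eps / 5]. *)
Lemma mixing_of_corr T : all_inv_mpt mu T ->
  (forall i j (eps : R), 0 < eps -> exists C : set G, compact C /\
     forall g, Gam g -> ~ C g ->
       `|mr (T g @` A i `&` A j) - mr (A i) * mr (A j)| < eps) ->
  gamma_mixing mu Gam T.
Proof.
move=> IT H B C mB mC eps eps0; have e50 : 0 < eps / 5 by rewrite divr_gt0.
have [i Bi] := denseA mB e50; have [j Cj] := denseA mC e50.
have [Q [cQ HQ]] := H i j _ e50; exists Q; split => // g Gg nQ.
have := HQ g Gg nQ.
have mi := measurable_im (IT g) (mA i); have mB' := measurable_im (IT g) mB.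
have h1 : `|mr (T g @` A i `&` A j) - mr (T g @` B `&` C)| <= D (A i) B + D (A j) C.
  apply: le_trans (dist_mr mu _ _) _; [exact: measurableI..|].
  apply: le_trans (dist_setI mu mi (mA j) mB' mC) _.
  by rewrite (im_dist (IT g)).
have h2 : `|mr (A i) * mr (A j) - mr B * mr C| <= D (A i) B + D (A j) C.
  rewrite (_ : _ - _ = (mr (A i) - mr B) * mr (A j) + mr B * (mr (A j) - mr C)); last by ring.
  apply: le_trans (ler_normD _ _) _; rewrite !normrM; apply: lerD.
    rewrite -[leRHS]mulr1 ler_pM// ?dist_mr//.
    by rewrite ger0_norm ?mr_ge0// mr_le1.
  rewrite -[leRHS]mul1r ler_pM// ?dist_mr//.
  by rewrite ger0_norm ?mr_ge0// mr_le1.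
move: h1 h2 Bi Cj; rewrite !ltr_norml !ler_norml.
move=> /andP[? ?] /andP[? ?] ? ? /andP[? ?].
by apply/andP; split; lra.
Qed.

Lemma mixing_complete (u : nat -> G -> X -> X) : (forall n, M (u n)) ->
  (forall eps : R, 0 < eps -> exists N, forall p q, (N <= p)%N -> (N <= q)%N ->
     m_dist (u p) (u q) < eps) ->
  exists T, M T /\ (fun n => m_dist (u n) T) @ \oo --> (0 : R).
Proof.
move=> Mu cu.
have Gam0 := unbounded_nonempty; have Kn0 := K_nonempty.
have Iu n : all_inv_mpt mu (u n) by case: (Mu n) => -[].
have Hu n : preaction mu (mul := mul) (u n) by case: (Mu n) => -[? []].
have pow2 k : 0 < 2 ^+ k :> R by rewrite exprn_gt0.
have cd i (eps : R) : 0 < eps -> I i -> exists N, forall p q, (N <= p)%N ->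
    (N <= q)%N -> forall g, K i g -> dA (u p g) (u q g) < eps.
  move=> eps0 Ii; have [N HN] := cu (eps / 2 ^+ i) (divr_gt0 eps0 (pow2 i)).
  exists N => p q Np Nq g Kg.
  apply: le_lt_trans (dA_le_m_dist mA Kn0 Gam0 (Iu p) (Iu q) Ii Kg) _.
  by rewrite mulrC -ltr_pdivlMr//; exact: HN.
have [SG [SK gen]] := genK.
have cK i g : I i -> K i g -> forall k, im_cauchy mu u g (A k).
  move=> Ii Kg k eps eps0.
  have [N HN] := cd i _ (divr_gt0 eps0 (pow2 k)) Ii.
  exists N => p q Np Nq.
  apply: le_lt_trans (im_le_dA mA _ (Iu p g) (Iu q g)) _.
  by rewrite mulrC -ltr_pdivlMr//; exact: HN.
have cKV i g : I i -> K i g -> forall k, im_cauchy mu u (inv g) (A k).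
  move=> Ii Kg k eps eps0.
  have [N HN] := cd i _ (divr_gt0 eps0 (pow2 k)) Ii.
  exists N => p q Np Nq; rewrite -(dist_preim_act Hgrp)//.
  apply: le_lt_trans (pre_le_dA mA _ (Iu p g) (Iu q g)) _.
  by rewrite mulrC -ltr_pdivlMr//; exact: HN.
have cau := im_cauchy_everywhere Hgrp mA denseA SK gen Hu cK cKV.
have [T [HT vT]] := preaction_limit Hgrp Leb Hu cau.
have IT := HT.1.
have vTp g B : measurable B -> vanish (fun n => D (u n g @^-1` B) (T g @^-1` B)).
  by move=> mB; apply: vanish_le (vT (inv g) B mB) => n; rewrite (dist_preim_act Hgrp).
have vd g : vanish (fun n => dA (u n g) (T g)).
  by apply: dA_vanish => // [n|B mB|B mB]; [exact: Iu|exact: vT|exact: vTp].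
have va g : vanish (fun n => aA (u n g) (T g)).
  by apply: aA_vanish => // [n|B mB]; [exact: Iu|exact: vT].
(* The index [N] is uniform in [g]: the index [N'] depends on [g], but it enters only through the
   intermediate stage [maxn N N'] of the triangle inequality. *)
have ud i (eps : R) : 0 < eps -> I i -> exists N, forall p, (N <= p)%N ->
    forall g, K i g -> dA (u p g) (T g) < eps.
  move=> eps0 Ii; have e20 : 0 < eps / 2 by rewrite divr_gt0.
  have [N HN] := cd i _ e20 Ii; exists N => p Np g Kg.
  have [N' HN'] := vd g _ e20.
  apply: le_lt_trans (dA_tri mA (Iu p g) (Iu (maxn N N') g) (IT g)) _.
  have := HN p _ Np (leq_maxl N N') g Kg; have := HN' _ (leq_maxr N N'); lra.
have ua (eps : R) : 0 < eps -> exists N, forall p, (N <= p)%N ->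
    forall g, Gam g -> aA (u p g) (T g) < eps.
  move=> eps0; have e20 : 0 < eps / 2 by rewrite divr_gt0.
  have [N HN] := cu _ e20; exists N => p Np g Gg.
  have [N' HN'] := va g _ e20.
  apply: le_lt_trans (aA_tri mA (Iu p g) (Iu (maxn N N') g) (IT g)) _.
  have := HN p _ Np (leq_maxl N N'); have := HN' _ (leq_maxr N N').
  have := aA_le_m_dist mA Kn0 (Iu p) (Iu (maxn N N')) Gg; lra.
(* The interior point [k0] is the one at which continuity of the limit is obtained first. *)
have [i0 Ii0] := index_nonempty; have [k0 Kk0] := K0 Ii0.
have unif B : measurable B -> forall eps : R, 0 < eps -> exists N, forall g,
    K i0 g -> D (u N g @` B) (T g @` B) < eps.
  move=> mB eps eps0; have e40 : 0 < eps / 4 by rewrite divr_gt0.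
  have [k Ak] := denseA mB e40.
  have [N HN] := ud i0 _ (divr_gt0 e40 (pow2 k)) Ii0.
  exists N => g Kg; have := HN N (leqnn N) g Kg; rewrite ltr_pdivlMr// mulrC => h.
  have := im_le_dA mA k (Iu N g) (IT g).
  have := im_dist_approx mA k (Iu N g) (IT g) mB; lra.
have actT : is_action mu mul T.
  split => //; split; first by case: HT.
  apply: (act_continuous_limit Hgrp (u := u) _ HT Kk0 unif) => n.
  by case: (Mu n).
have mixT : gamma_mixing mu Gam T.
  apply: mixing_of_corr => // i j eps eps0; have e20 : 0 < eps / 2 by rewrite divr_gt0.
  have pow2V k : 0 < (2 ^+ k)^-1 :> R by rewrite invr_gt0.
  (* The inverse powers of 2 cancel the weights lost in [corr_le_aA]. *)
  have [N HN] := ua _ (mulr_gt0 (pow2V i) (mulr_gt0 (pow2V j) e20)).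
  have [_ mixN] := Mu N.
  have [C [cC HC]] := mixN _ _ (mA i) (mA j) _ e20.
  exists C; split => // g Gg nC; have := HC g Gg nC.
  have := HN N (leqnn N) g Gg; rewrite ltr_pdivlMl// ltr_pdivlMl// => h.
  have := corr_le_aA mA i j (Iu N g) (IT g).
  move/le_lt_trans => /(_ _ h); rewrite !ltr_norml => /andP[? ?] /andP[? ?].
  by apply/andP; split; lra.
exists T; split => //.
apply/cvgrPdist_le => eta eta0.
have [L [eps eps0 H]] := m_dist_small mu mA Kn0 Gam0 eta0.
have /choice[NK HNK] i : exists N, I i -> forall p, (N <= p)%N ->
    forall g, K i g -> dA (u p g) (T g) < eps.
  have [Ii|nI] := boolP (I i); last by exists 0%N.
  by have [N HN] := ud i _ eps0 Ii; exists N.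
have [NG HNG] := ua _ eps0.
exists (maxn NG (\max_(i < L) NK i)) => // n /=; rewrite geq_max => /andP[n1 /bigmax_leqP n2].
rewrite sub0r normrN ger0_norm; last exact: m_dist_ge0.
apply: H => // [i g iL Ii Kg|g Gg]; last exact/ltW/HNG.
by apply/ltW; exact: (HNK i Ii n (n2 (Ordinal iL) isT) g Kg).
Qed.

End Completeness.

(** * Separability *)

Section Covers.
Context {G : topologicalType} {mul : G -> G -> G} {inv : G -> G} {e : G}.
Hypothesis Hgrp : lc_group mul inv e.

Lemma nbhs_gmull a x (V : set G) : nbhs (mul a x) V -> nbhs x [set y | V (mul a y)].
Proof. exact: (gmull_continuous Hgrp). Qed.

Lemma nbhs_gmulr a x (V : set G) : nbhs (mul x a) V -> nbhs x [set y | V (mul y a)].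
Proof. exact: (gmulr_continuous Hgrp). Qed.

Lemma nbhs_ginv x (V : set G) : nbhs (inv x) V -> nbhs x [set y | V (inv y)].
Proof. exact: (ginv_continuous Hgrp). Qed.

(** The near-covering form of compactness is applied to the filter of finite sequences directed by
    inclusion: near each point of [C] the covering relation holds for all sequences containing a
    suitable label, so a single sequence serves all of [C]. *)
Lemma compact_translate_cover (W : eqType) (H : W -> G) (C V : set G) :
  compact C ->
  (forall g, C g -> exists w, nbhs (mul (inv (H w)) g) V) ->
  exists s : seq W, forall g, C g -> exists2 w, w \in s & V (mul (inv (H w)) g).
Proof.
move=> /compact_near_coveringP cC cov.
pose F : set_system (seq W) :=
  [set Q | exists s0 : seq W, forall s : seq W, {subset s0 <= s} -> Q s].
have FF : Filter F.
  split; first by exists [::].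
  - move=> P Q [s1 H1] [s2 H2]; exists (s1 ++ s2) => s sub.
    by split; [apply: H1|apply: H2] => w ws; apply: sub; rewrite mem_cat ws ?orbT.
  - by move=> P Q PQ [s1 H1]; exists s1 => s /H1 /PQ.
have [|s0 Hs0] := cC _ F (fun s g => exists2 w, w \in s & V (mul (inv (H w)) g)) FF.
  move=> g /cov[w Vw].
  exists ([set y | V (mul (inv (H w)) y)], [set s : seq W | w \in s]).
    split => /=; first exact: nbhs_gmull.
    by exists [:: w] => s; apply; rewrite inE.
  by move=> [y s] [/= Vy ws]; exists w.
by exists s0; apply: Hs0.
Qed.

(** A letter [(b, (i, n, k))] stands for the center number [k] in a cover of [K i] by translates of
    [U n], inverted when [b] is false. Words form a countable type. *)
Definition word : Type := seq (bool * (nat * nat * nat)).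

Definition word_eval (delta : nat * nat * nat -> G) (w : word) : G :=
  foldr (fun x g => mul (if x.1 then delta x.2 else inv (delta x.2)) g) e w.

Lemma word_eval_cat delta w1 w2 :
  word_eval delta (w1 ++ w2) = mul (word_eval delta w1) (word_eval delta w2).
Proof.
elim: w1 => [|x w1 IH] /=; first by rewrite (gemul Hgrp).
by rewrite IH (gmulA Hgrp).
Qed.

Lemma word_eval_inv delta w : exists w', word_eval delta w' = inv (word_eval delta w).
Proof.
elim: w => [|[b x] w [w' IH]]; first by exists [::]; rewrite /= (ginve Hgrp).
exists (w' ++ [:: (~~ b, x)]); rewrite word_eval_cat IH /= (gmule Hgrp) (ginvM Hgrp).
by case: b => //=; rewrite (ginvK Hgrp).
Qed.

(* Words in the centers of finite covers of the [K i] by translates of the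
   members of the neighborhood base are dense, as their closure is a subgroup. *)
Lemma dense_words (I : pred nat) (K : nat -> set G) (SG : set G) (U : nat -> set G) :
  SG `<=` \bigcup_(i in [set i | I i]) K i -> generates_group mul inv e SG ->
  (forall i, I i -> compact (K i)) ->
  (forall n, nbhs e (U n)) ->
  (forall V, nbhs e V -> exists n, U n `<=` V) ->
  exists ev : word -> G,
    forall g V, nbhs e V -> exists w, V (mul (inv (ev w)) g).
Proof.
move=> SK gen cK U0 Ub.
have /choice[F HF] (x : nat * nat) : exists s : seq G, I x.1 -> forall g, K x.1 g ->
    exists2 h, h \in s & U x.2 (mul (inv h) g).
  have [Ii|nI] := boolP (I x.1); last by exists [::].
  have [|s Hs] := @compact_translate_cover _ id (K x.1) (U x.2) (cK _ Ii).
    by move=> g _; exists g; rewrite /= (gVmul Hgrp); exact: U0.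
  by exists s.
pose delta (x : nat * nat * nat) := nth e (F x.1) x.2.
pose ev := word_eval delta; exists ev.
pose H := [set g | forall V, nbhs e V -> exists w, V (mul (inv (ev w)) g)].
suff HT : H = setT by move=> g; have : H g by rewrite HT.
apply: gen; first split.
- move=> V V0; exists [::]; rewrite /= (gmule Hgrp) (ginve Hgrp).
  exact: nbhs_singleton.
- split=> [x y Hx Hy V V0|x Hx V V0].
    (* The group need not be commutative, so [w2] comes first and the neighborhood of [e] used for
       [w1] depends on it. The interior makes [V] a neighborhood of [mul (inv (ev w2)) y]. *)
    have [w2 Vw2] := Hy _ (nbhs_interior V0).
    have [|w1 Vw1] := Hx [set a | V (mul (mul (inv (ev w2)) a) y)].
      apply: (@nbhs_gmull _ _ [set z | V (mul z y)]); apply: nbhs_gmulr.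
      by rewrite (gmule Hgrp).
    exists (w1 ++ w2); rewrite /ev word_eval_cat (ginvM Hgrp).
    by move: Vw1; rewrite /= !(gmulA Hgrp).
  (* For [a = mul (inv (ev w1)) x], the conjugate of [inv a] by [x] is [mul (ev w1) (inv x)], the
     error of the inverse word at [inv x]. *)
  have [|w1 /= Vw1] := Hx [set a | V (mul (mul x (inv a)) (inv x))].
    apply: (@nbhs_ginv _ [set b | V (mul (mul x b) (inv x))]).
    rewrite (ginve Hgrp); apply: (@nbhs_gmull _ _ [set z | V (mul z (inv x))]).
    by apply: nbhs_gmulr; rewrite (gmule Hgrp) (gmulV Hgrp).
  have [w' Hw'] := word_eval_inv delta w1.
  exists w'; move: Vw1; rewrite (Hw' : ev w' = inv (ev w1)) (ginvM Hgrp).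
  by rewrite !(ginvK Hgrp) (gmulA Hgrp) (gmulV Hgrp) (gemul Hgrp).
- move=> g /SK[i /= Ii Kg] V /Ub[n UV].
  have [h hF Uh] := HF (i, n) Ii g Kg.
  exists [:: (true, (i, n, index h (F (i, n))))].
  by rewrite /ev /= /delta /= nth_index// (gmule Hgrp); exact: UV.
Qed.

End Covers.

(** * Finite codes for mixing actions *)

Section Separability.
Context {R : realType} {d : measure_display} {X : measurableType d}
  (mu : probability X R) {G : topologicalType} {mul : G -> G -> G}
  {inv : G -> G} {e : G} (A : nat -> set X)
  (I : pred nat) (K : nat -> set G) (Gam : set G).
Hypothesis Hgrp : lc_group mul inv e.
Hypothesis mA : forall i, measurable (A i).
Hypothesis denseA : forall B, measurable B -> forall eps : R, 0 < eps ->
  exists i, mr mu (symdiff (A i) B) < eps.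
Hypothesis cK : forall i, I i -> compact (K i).
Hypothesis K0 : forall i, I i -> K i !=set0.
Hypothesis Gam0 : Gam !=set0.
Hypothesis genK : exists SG : set G, SG `<=` \bigcup_(i in [set i | I i]) K i /\
  generates_group mul inv e SG.
Implicit Types (B C E : set X) (T S : G -> X -> X).

Local Notation mr := (mr mu).
Local Notation D A B := (mr (symdiff A B)).
Local Notation dA := (dA mu A).
Local Notation aA := (aA mu A).
Local Notation m_dist := (m_dist mu A I K Gam).
Local Notation M := (mixing_actions mu mul Gam).

(** As [T g] preserves measure, both halves of the symmetric difference have measure [mr B] minus
    the correlation of [B] with itself at [g], which is continuous and equals [mr B] at [e]. *)
Lemma act_nbhs_e T B (eps : R) : is_action mu mul T -> measurable B -> 0 < eps ->
  nbhs e [set g | D (T g @` B) B < eps].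
Proof.
move=> [IT [HT cT]] mB eps0; have e20 : 0 < eps / 2 by rewrite divr_gt0.
have HTp : preaction mu (mul := mul) T by [].
have meB := measurable_im (IT e) mB.
have Te : mr (T e @` B `&` B) = mr B.
  by rewrite (@mr_setI_congr _ _ _ _ _ B)// ?setIid// (act_e Hgrp HTp mB).
have /cvgrPdist_lt/(_ _ e20) := cT B B mB mB e; rewrite Te.
apply: filterS => g; rewrite ltr_norml => /andP[_ h] /=.
have mgB := measurable_im (IT g) mB.
apply: le_lt_trans (mrU mu (measurableD mgB mB) (measurableD mB mgB)) _.
have := mrDI mu mgB mB; have := mrDI mu mB mgB; rewrite (mr_im (IT g) mB).
by move: h; rewrite [B `&` _]setIC; lra.
Qed.

Variables (U : nat -> set G) (ev : word -> G).
Hypothesis U0 : forall n, nbhs e (U n).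
Hypothesis Ub : forall V, nbhs e V -> exists n, U n `<=` V.
Hypothesis dense_ev : forall g V, nbhs e V -> exists w, V (mul (inv (ev w)) g).

(** The components are the index of a basic neighborhood of [e], the words whose values are the
    centers of its translates, and for each word a list of indices into the dense family. The type
    is countable. *)
Definition code_type : Type := (nat * seq word * seq (seq nat))%type.

Let covered (q : code_type) g :=
  exists2 w, w \in q.1.2 & U q.1.1 (mul (inv (ev w)) g).

(** The first and last clauses locate the images of [A i] at covered elements. The second makes the
    first [K i] and their inverses covered, and the third treats the rest of [Gam]. The code records
    [j] only on its own words and on indices below [L]. *)
Definition good_code (L : nat) (eps : R) T (q : code_type) :=
  [/\ (forall g i, U q.1.1 g -> (i < L)%N -> D (T g @` A i) (A i) < eps),
      (forall i g, (i < L)%N -> I i -> K i g -> covered q g /\ covered q (inv g)),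
      (forall g, Gam g -> ~ covered q g -> forall i j, (i < L)%N -> (j < L)%N ->
         `|mr (T g @` A i `&` A j) - mr (A i) * mr (A j)| < eps) &
      exists j : word -> nat -> nat,
        q.2 = [seq [seq j w i | i <- iota 0 L] | w <- q.1.2] /\
        forall w i, D (T (ev w) @` A i) (A (j w i)) < eps].

Lemma compact_word_cover (C V : set G) : compact C -> nbhs e V ->
  exists s : seq word, forall g, C g -> exists2 w, w \in s & V (mul (inv (ev w)) g).
Proof.
move=> cC V0; apply: (compact_translate_cover Hgrp cC) => g _.
have [w Vw] := dense_ev g (nbhs_interior V0).
by exists w.
Qed.

Lemma good_code_ex (L : nat) (eps : R) T : 0 < eps -> M T ->
  exists q, good_code L eps T q.
Proof.
move=> eps0 [actT mixT]; have IT := actT.1.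
have [n Hn] : exists n, forall g, U n g -> forall i, (i < L)%N -> D (T g @` A i) (A i) < eps.
  apply: Ub; elim: (L) => [|l IH]; first exact: nearW.
  have h := act_nbhs_e actT (mA l) eps0.
  apply: filterS (filterI IH h) => g [/= h1 h2] i.
  by rewrite ltnS leq_eqVlt => /orP[/eqP ->|/h1].
have [s1 Hs1] : exists s : seq word, forall i g, (i < L)%N -> I i -> K i g ->
    (exists2 w, w \in s & U n (mul (inv (ev w)) g)) /\
    (exists2 w, w \in s & U n (mul (inv (ev w)) (inv g))).
  elim: (L) => [|l [s IH]]; first by exists [::].
  have [Il|nI] := boolP (I l); last first.
    exists s => i g; rewrite ltnS leq_eqVlt => /orP[/eqP ->|]; last exact: IH.
    by rewrite (negbTE nI).
  have [t1 H1] := compact_word_cover (cK Il) (U0 n).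
  (* The inverses of the elements of [K l] are covered too, for the preimage half of [dA]. *)
  have cV : compact (inv @` K l).
    apply: continuous_compact; last exact: cK.
    by apply: continuous_subspaceT; exact: (ginv_continuous Hgrp).
  have [t2 H2] := compact_word_cover cV (U0 n).
  exists (s ++ (t1 ++ t2)) => i g; rewrite ltnS leq_eqVlt => /orP[/eqP ->|il] Ii Kg.
    have [w1 w1s Uw1] := H1 g Kg.
    have [|w2 w2s Uw2] := H2 (inv g); first by exists g.
    by split; [exists w1|exists w2] => //; rewrite !mem_cat ?w1s ?w2s !orbT.
  have [[w1 w1s Uw1] [w2 w2s Uw2]] := IH i g il Ii Kg.
  by split; [exists w1|exists w2] => //; rewrite mem_cat ?w1s ?w2s.
have [s2 Hs2] : exists s : seq word, forall g, Gam g ->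
    ~ (exists2 w, w \in s & U n (mul (inv (ev w)) g)) ->
    forall i j, (i < L)%N -> (j < L)%N ->
    `|mr (T g @` A i `&` A j) - mr (A i) * mr (A j)| < eps.
  have /choice[C HC] (x : nat * nat) := mixT _ _ (mA x.1) (mA x.2) eps eps0.
  have /choice[t Ht] x := compact_word_cover (HC x).1 (U0 n).
  (* An element that is not covered lies outside [C (i, j)] for all [i] and [j] below [L], so mixing
     applies to it. *)
  exists (flatten [seq t (i, j) | i <- iota 0 L, j <- iota 0 L]) => g Gg ncov i j iL jL.
  apply: (HC (i, j)).2 => // Cg; have [w ws Uw] := Ht (i, j) g Cg.
  apply: ncov; exists w => //; apply/flattenP; exists (t (i, j)) => //.
  by apply: allpairs_f; rewrite mem_iota.
have /choice[j Hj] (x : word * nat) := denseA (measurable_im (IT (ev x.1)) (mA x.2)) eps0.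
exists (n, s1 ++ s2, [seq [seq j (w, i) | i <- iota 0 L] | w <- s1 ++ s2]); split.
- by move=> g i /Hn; apply.
- move=> i g iL Ii Kg; have [[w1 w1s Uw1] [w2 w2s Uw2]] := Hs1 i g iL Ii Kg.
  by split; [exists w1|exists w2] => //=; rewrite mem_cat ?w1s ?w2s.
- move=> g Gg ncov; apply: Hs2 => // -[w ws Uw]; apply: ncov.
  by exists w => //=; rewrite mem_cat ws orbT.
- exists (fun w i => j (w, i)); split => // w i; rewrite symdiffC.
  exact: (Hj (w, i)).
Qed.

(** Write [g] as [ev w] times an element of the basic neighborhood. Under either action that element
    moves [A i] by less than [eps], and [ev w] takes [A i] to within [eps] of the same recorded set;
    this gives [2 * eps] for each action. *)
Lemma good_code_close (L : nat) (eps : R) T S q g i : is_action mu mul T ->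
  is_action mu mul S -> good_code L eps T q -> good_code L eps S q ->
  covered q g -> (i < L)%N -> D (T g @` A i) (S g @` A i) <= 4 * eps.
Proof.
move=> aT aS [T1 _ _ [jT [qT T4]]] [S1 _ _ [jS [qS S4]]] [w ws Uw] iL.
have jE : jT w i = jS w i.
  move: qT; rewrite qS => /eq_in_map/(_ w ws)/eq_in_map/(_ i) -> //.
  by rewrite mem_iota.
have near Q : is_action mu mul Q ->
    D (Q (mul (inv (ev w)) g) @` A i) (A i) < eps ->
    D (Q (ev w) @` A i) (A (jT w i)) < eps ->
    D (Q g @` A i) (A (jT w i)) <= 2 * eps.
  move=> [IQ [HQ _]] h1 h2; have HQp : preaction mu (mul := mul) Q by [].
  set v := mul (inv (ev w)) g in h1.
  have m1 := measurable_im (IQ g) (mA i); have m2 := measurable_im (IQ v) (mA i).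
  have m3 := measurable_im (IQ (ev w)) m2.
  have m4 := measurable_im (IQ (ev w)) (mA i).
  have := act_mul (ev w) v HQp (mA i); rewrite /v (gmulVK Hgrp) -/v => h3.
  have := dist_tri mu m1 m3 (mA (jT w i)); have := dist_tri mu m3 m4 (mA (jT w i)).
  by rewrite h3 (im_dist (IQ (ev w)) m2 (mA i)); lra.
have hT := near T aT (T1 _ i Uw iL) (T4 w i).
have := S4 w i; rewrite -jE => h; have hS := near S aS (S1 _ i Uw iL) h.
have := dist_tri mu (measurable_im (aT.1 g) (mA i)) (mA (jT w i))
  (measurable_im (aS.1 g) (mA i)).
by rewrite (symdiffC (A _)); lra.
Qed.

Lemma good_code_m_dist (eta : R) : 0 < eta -> exists L, exists2 eps : R, 0 < eps &
  forall T S q, M T -> M S -> good_code L eps T q -> good_code L eps S q ->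
    m_dist T S <= eta.
Proof.
move=> eta0.
have [L1 [eps1 eps10 H1]] := m_dist_small mu mA K0 Gam0 eta0.
have [L2 [eps2 eps20 H2]] := dA_small mu mA eps10.
have [L3 [eps3 eps30 H3]] := aA_small mu mA eps10.
pose L := maxn L1 (maxn L2 L3).
have L1L : (L1 <= L)%N by rewrite leq_maxl.
have L2L : (L2 <= L)%N by rewrite !leq_max leqnn orbT.
have L3L : (L3 <= L)%N by rewrite !leq_max leqnn !orbT.
(* The division by 4 absorbs the factor in [good_code_close]. *)
pose eps := Num.min eps2 eps3 / 4.
have eps_2 : 4 * eps <= eps2.
  by rewrite /eps mulrC divfK// ge_min lexx.
have eps_3 : 4 * eps <= eps3.
  by rewrite /eps mulrC divfK// ge_min lexx orbT.
have eps0 : 0 < eps by rewrite divr_gt0// lt_min eps20.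
exists L, eps => // T S q [aT _] [aS _] gT gS.
have IT := aT.1; have IS := aS.1.
have HT : preaction mu (mul := mul) T by case: aT => ? [].
have HS : preaction mu (mul := mul) S by case: aS => ? [].
apply: H1 => // [i g iL Ii Kg|g Gg].
  have [_ gT2 _ _] := gT.
  have [c1 c2] := gT2 i g (leq_trans iL L1L) Ii Kg.
  apply: H2 => // k kL; have kL' := leq_trans kL L2L.
  split; first exact: le_trans (good_code_close aT aS gT gS c1 kL') eps_2.
  rewrite (dist_preim_act Hgrp)//.
  exact: le_trans (good_code_close aT aS gT gS c2 kL') eps_2.
apply: H3 => // i j iL jL.
have iL' := leq_trans iL L3L; have jL' := leq_trans jL L3L.
have [cov|ncov] := pselect (covered q g).
  apply: le_trans (corr_le_dist mA i j (IT g) (IS g)) _.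
  exact: le_trans (good_code_close aT aS gT gS cov iL') eps_3.
(* At an uncovered [g] both correlations are within [eps] of the same product of measures. *)
have [_ _ gT3 _] := gT; have [_ _ gS3 _] := gS.
have := gT3 g Gg ncov i j iL' jL'; have := gS3 g Gg ncov i j iL' jL'.
rewrite !ltr_norml ler_norml => /andP[? ?] /andP[? ?].
by apply/andP; split; lra.
Qed.

Lemma mixing_separable : exists Q : set (G -> X -> X), countable Q /\ Q `<=` M /\
  forall T, M T -> forall eps : R, 0 < eps -> exists S, Q S /\ m_dist T S < eps.
Proof.
have /choice[code Hcode] (k : nat) : exists c : (G -> X -> X) -> code_type,
    forall T S, M T -> M S -> c T = c S -> m_dist T S <= k.+1%:R^-1.
  have k0 : 0 < k.+1%:R^-1 :> R by rewrite invr_gt0.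
  have [L [eps eps0 H]] := good_code_m_dist k0.
  (* An action may have several good codes; [c] selects one, with an empty code as default outside
     [M]. *)
  have /choice[c Hc] T : exists q, M T -> good_code L eps T q.
    have [MT|nM] := pselect (M T); last by exists (0%N, [::], [::]).
    by have [q Hq] := good_code_ex L eps0 MT; exists q.
  by exists c => T S MT MS cTS; apply: H (Hc T MT) _ => //; rewrite cTS; exact: Hc.
have /choice[pick Hpick] (x : nat * code_type) : exists S,
    (exists T, M T /\ code x.1 T = x.2) -> M S /\ code x.1 S = x.2.
  have [[S HS]|nS] := pselect (exists T, M T /\ code x.1 T = x.2).
    by exists S.
  by exists (fun=> id) => /nS.
(* Intersecting with [M] guards against the default picked for codes that no mixing action has. *)
exists (M `&` pick @` setT); split; last split => //.
  apply: (@sub_countable _ _ _ [set: nat * code_type]); last exact: countableP.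
  by apply: card_le_trans (card_image_le pick _); apply: subset_card_le => T [].
move=> T MT eps eps0.
have [k Hk] : exists k, k.+1%:R^-1 < eps.
  have /cvgrPdist_lt/(_ eps eps0)[k _ Hk] := @cvg_harmonic R.
  exists k; have := Hk k (leqnn k); rewrite /= sub0r normrN.
  by apply: le_lt_trans; rewrite ler_norm.
have [|MS cS] := Hpick (k, code k T); first by exists T.
exists (pick (k, code k T)); split; first by split => //; exists (k, code k T).
by apply: le_lt_trans Hk; apply: Hcode => //; rewrite cS.
Qed.

End Separability.

(** * The complete separable metric space of mixing actions *)

Unset Implicit Arguments. Set Strict Implicit. Set Printing Implicit Defensive.

Theorem theorem1 (R : realType) (d : measure_display) (X : measurableType d)
    (mu : probability X R) (A : nat -> set X)
    (G : topologicalType) (mul : G -> G -> G) (inv : G -> G) (e : G)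
    (I : pred nat) (K : nat -> set G) (Gam : set G) :
  nonatomic_lebesgue_space mu -> nonatomic mu ->
  (forall i, measurable (A i)) ->
  <<s range A>> = measurable ->
  (forall B, measurable B -> forall eps : R, 0 < eps ->
     exists i, mr mu (symdiff (A i) B) < eps) ->
  lc_group mul inv e ->
  (forall i, I i -> compact (K i) /\ interior (K i) !=set0) ->
  (exists S, S `<=` \bigcup_(i in [set i | I i]) K i /\ generates_group mul inv e S) ->
  unbounded Gam ->
  complete_separable_metric (mixing_actions mu mul Gam) (act_equiv mu (G:=G))
    (m_dist mu A I K Gam).
Proof.
move=> Leb _ mA _ denseA Hgrp KP genK unbG.
have Gam0 := unbounded_nonempty unbG.
have K0 i : I i -> K i !=set0 by move=> /KP[_ [g /interior_subset Kg]]; exists g.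
have MI T : mixing_actions mu mul Gam T -> all_inv_mpt mu T by move=> [[]].
have MP T : mixing_actions mu mul Gam T -> preaction mu (mul := mul) T.
  by move=> [[? []]].
split.
- move=> T S MT MS; split; first by apply: m_dist_ge0 => //; exact: MI.
  split; first exact: (ae_equal_m_dist Hgrp mA denseA K0 Gam0 genK Leb (MP _ MT) (MP _ MS)).
  by apply: m_dist_ae_equal => //; exact: MI.
- by move=> T S MT MS; apply: m_dist_sym => //; exact: MI.
- by move=> T S U MT MS MU; apply: m_dist_tri => //; exact: MI.
- move=> u Mu cu; apply: (mixing_complete Hgrp Leb mA denseA _ genK unbG Mu cu).
  by move=> i /KP[].
- have [_ [_ _ base]] := Hgrp; have [U [U0 Ub]] := base e.
  have [SG [SK gen]] := genK.
  have cK i : I i -> compact (K i) by move=> /KP[].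
  have [ev dense_ev] := dense_words Hgrp SK gen cK U0 Ub.
  exact: (mixing_separable Hgrp mA denseA cK K0 Gam0 U0 Ub dense_ev).
Qed.
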